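(* Fix an integer $d\ge 2$. Let $\mathcal D$ be a distribution on $\mathbb S^{d-1}\times\mathbb R$ whose $x$-marginal is the uniform distribution on $\mathbb S^{d-1}$ and with $y=f^*(x)+\xi$, where $f^*\in L^2(\mathbb S^{d-1})$ is fixed (independent of $m$) and $\xi$ is independent noise with mean $0$ and variance $\sigma^2>0$. For each sample size $m$ let $\tau_m>0$ and consider the Gaussian kernel $K_m(x,t)=\exp(-\|x-t\|_2^2/\tau_m^2)$. Let $\tilde R(\hat f_0)$ denote the predicted risk of the minimum-norm interpolant (defined in the context) for kernel $K_m$ and sample size $m$, and let $\tilde R(0)=\sigma^2+\|f^*\|^2$. Then: 1. If $\tau_m=o(m^{-1/(d-1)})$, then $\tilde R(0)\le\liminf_{m\to\infty}\tilde R(\hat f_0)\le\limsup_{m\to\infty}\tilde R(\hat f_0)<\infty$. More precisely, there is a scalar $c_d$ depending only on $d$ such that, whenever $\tau_m\le m^{-1/(d-1)}t(m)$ with $t(m)\to0$ as $m\to\infty$, there is $m_0$ (depending on $t$) such that for all $m>m_0$, $\tilde R(\hat f_0)>\sigma^2+(1-c_d\,t(m)^{(d-1)/2})\|f^*\|^2$. 2. If $\tau_m=\omega(m^{-1/(d-1)})$, then $\lim_{m\to\infty}\tilde R(\hat f_0)=\infty$; hence for all large enough $m$, $\tilde R(\hat f_0)>\tilde R(0)$. 3. If $\tau_m=\Theta(m^{-1/(d-1)})$, then $\limsup_{m\to\infty}\tilde R(\hat f_0)<\infty$. Moreover, if $C_1m^{-1/(d-1)}\le\tau_m\le C_2m^{-1/(d-1)}$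 for all $m$, for constants $C_1,C_2>0$, then there exist $\eta,\mu>0$ depending only on $d,C_1,C_2$ such that for all $m$, $\tilde R(\hat f_0)>\mu\|f^*\|^2+(1+\eta)\sigma^2$. Consequently $\tilde R(\hat f_0)>\tilde R(0)$ whenever $\sigma^2>\frac{1-\mu}{\eta}\|f^*\|^2$.
   Context: Eigenframework (predicted risk). For a positive semi-definite kernel $K$ on $\mathcal X$ and the $x$-marginal $\mu$ of the data, write Mercer's decomposition $K(x,t)=\sum_{i\ge1}\lambda_i\phi_i(x)\phi_i(t)$, where $\lambda_1\ge\lambda_2\ge\dots>0$ are the eigenvalues (listed with multiplicity) of the integral operator $f\mapsto\int K(\cdot,t)f(t)\,d\mu(t)$ on $L^2(\mu)$ and $\{\phi_i\}$ is the corresponding orthonormal eigenbasis. Expand $f^*=\sum_i\beta_i\phi_i$, so $\|f^*\|^2:=\|\beta\|_2^2=\mathbb E_\mu[f^*(x)^2]$. For sample size $m$, let $\kappa_0>0$ solve $\sum_i\frac{\lambda_i}{\lambda_i+\kappa_0}=m$, let $\mathcal L_i=\frac{\lambda_i}{\lambda_i+\kappa_0}$ and $\mathcal E_0=\frac{m}{m-\sum_i\mathcal L_i^2}$. The predicted test risk of the minimum-norm interpolating (ridgeless) kernel regression solution $\hat f_0$ is $\tilde R(\hat f_0)=\mathcal E_0\big(\sum_i(1-\mathcal L_i)^2\beta_i^2+\sigma^2\big)$, and the risk of the null predictor is $\tilde R(0)=\sigma^2+\|f^*\|^2$. For the Gaussian kernel with bandwidth $\tau$ and $\mu$ uniform on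 $\mathbb S^{d-1}$, the eigenfunctions are the spherical harmonics; the degree-$k$ harmonics ($k\ge0$) share the eigenvalue $e^{-2/\tau^2}\tau^{d-2}I_{k+d/2-1}(2/\tau^2)\Gamma(d/2)$ (with $I_v$ the modified Bessel function of the first kind), with multiplicity $N(d,k)=\frac{(2k+d-2)(k+d-3)!}{k!(d-2)!}$. *)

(* Defs.v *)
From Stdlib Require Import Reals List ClassicalEpsilon Factorial.
From Coquelicot Require Import Coquelicot.
Open Scope R_scope.

Definition fsum (n : nat) (f : nat -> R) : R :=
  fold_right Rplus 0 (map f (seq 0 n)).

Definition Gamma (s : R) : R :=
  RInt_gen (fun t => Rpower t (s - 1) * exp (- t))
           (at_right 0) (Rbar_locally p_infty).

Definition BesselI (v z : R) : R :=
  Series (fun n => Rpower (z / 2) (2 * INR n + v)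
                   / (INR (fact n) * Gamma (INR n + v + 1))).

(* Multiplicity of degree-k spherical harmonics on S^{d-1}:
   N(d,k) = (2k+d-2)(k+d-3)!/(k!(d-2)!), with the standard convention
   N(d,0) = 1 (needed for d = 2, where the formula is degenerate). *)
Definition Nmult (d k : nat) : nat :=
  match k with
  | O => 1%nat
  | _ => Nat.div ((2 * k + d - 2) * fact (k + d - 3)) (fact k * fact (d - 2))
  end.

(* Eigenvalue shared by the degree-k harmonics, Gaussian kernel with
   bandwidth tau, uniform measure on S^{d-1}. *)
Definition lam (d : nat) (tau : R) (k : nat) : R :=
  exp (- 2 / tau ^ 2) * tau ^ (d - 2)
  * BesselI (INR k + INR d / 2 - 1) (2 / tau ^ 2) * Gamma (INR d / 2).

Definition eff_dof (d : nat) (tau kappa : R) : R :=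
  Series (fun k => INR (Nmult d k) * (lam d tau k / (lam d tau k + kappa))).

Definition kappa0 (d : nat) (tau : R) (m : nat) : R :=
  epsilon (inhabits 0) (fun kappa => 0 < kappa /\ eff_dof d tau kappa = INR m).

Definition Lk (d : nat) (tau : R) (m k : nat) : R :=
  lam d tau k / (lam d tau k + kappa0 d tau m).

Definition E0 (d : nat) (tau : R) (m : nat) : R :=
  INR m / (INR m - Series (fun k => INR (Nmult d k) * (Lk d tau m k) ^ 2)).

(* f^* is given by its coefficients beta k j in the spherical-harmonic
   eigenbasis: degree k, index j < N(d,k). *)
Definition deg_energy (d : nat) (beta : nat -> nat -> R) (k : nat) : R :=
  fsum (Nmult d k) (fun j => (beta k j) ^ 2).

Definition fstar_sq (d : nat) (beta : nat -> nat -> R) : R :=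
  Series (deg_energy d beta).

Definition pred_risk (d : nat) (tau : R) (m : nat) (sigma2 : R)
  (beta : nat -> nat -> R) : R :=
  E0 d tau m *
  (Series (fun k => (1 - Lk d tau m k) ^ 2 * deg_energy d beta k) + sigma2).

Definition null_risk (d : nat) (sigma2 : R) (beta : nat -> nat -> R) : R :=
  sigma2 + fstar_sq d beta.

Definition scale (d m : nat) : R := Rpower (INR m) (- (1 / INR (d - 1))).

(* Main.v *)
Require Import Defs.
From Stdlib Require Import Reals Lra Lia Psatz Factorial ClassicalEpsilon.
From Coquelicot Require Import Coquelicot.
Open Scope R_scope.

(** Only ratios of eigenvalues matter, and these are governed by the three-term recurrence
    [I_v = (2 (v + 1) / z) I_(v+1) + I_(v+2)] with [z = 2 / tau^2]: it gives
    [z / (z + 2 v + 2) <= I_(v+1) / I_v <= z / (z + v)], so the spectrum is flat up to degree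
    about [x = sqrt z] and decays beyond it, and about [x^(d-1)] eigenfunctions have degree
    at most [x]. Write [L_k = w_k / (w_k + kappa)] for the eigenvalues [w_k].

    If [x^(d-1)] is large compared with [m], flatness forces [L_0] to be of order
    [m / x^(d-1)], and [E_0 <= 1 / (1 - L_0)]. If the two are comparable, [kappa] is comparable
    to [w_0], so that [L_0] stays away from [1] and [sum L^2] is at least a fixed fraction
    of [m]. If [x^(d-1)] is small compared with [m], the upper bound on the ratios reads
    [L_k (1 - L_k) <= (1 + z / k) (L_k - L_(k+1))], and summation by parts shows that
    [m - sum L^2 = sum L (1 - L)] is [o(m)], so that [E_0] diverges. *)

(** * Series with nonnegative terms *)

(** Two definitions carry information only once something converges or is solvable: [Gamma] is an
    improper integral, and [kappa0] is a choice by [epsilon]. Hence the study of [Gamma] on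
    [[1, infinity)], which contains every argument that occurs, and an intermediate value argument
    for the effective degrees of freedom. After that, Bessel functions enter only through
    [bessel_like]. The delicate estimate is the upper bound on the ratios. Dropping the last term of
    the recurrence gives [w (S k) / w k <= z / (2 k + d)], which says nothing for [k] below about
    [z / 2], whereas decay sets in near [sqrt z], where the ratio differs from [1] only by order
    [k / z]. A sharper bound is therefore carried down from very large degrees. The constants may
    not depend on [m], the noise or the target, so the spectral estimates are nonasymptotic: a
    regime enters them only through inequalities between [x], [M] and fixed constants. *)

Lemma sum_n_incr (a : nat -> R) n : (forall k, 0 <= a k) -> sum_n a n <= sum_n a (S n).
Proof. intros Ha. rewrite sum_Sn. unfold plus; simpl. pose proof (Ha (S n)). lra. Qed.

Lemma sum_n_le_Series (a : nat -> R) n :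
  (forall k, 0 <= a k) -> ex_series a -> sum_n a n <= Series a.
Proof.
intros Ha Hex. apply (is_lim_seq_incr_compare (sum_n a)).
- apply (Series_correct a Hex).
- intros k. now apply sum_n_incr.
Qed.

Lemma Series_le_of_sum_n_le (a : nat -> R) M :
  ex_series a -> (forall n, sum_n a n <= M) -> Series a <= M.
Proof.
intros Hex Ha.
apply (is_lim_seq_le (sum_n a) (fun _ => M) (Series a) M Ha).
- apply (Series_correct a Hex).
- apply is_lim_seq_const.
Qed.

Lemma ex_series_of_bounded (a : nat -> R) M :
  (forall k, 0 <= a k) -> (forall n, sum_n a n <= M) -> ex_series a.
Proof.
intros Ha HM.
destruct (ex_finite_lim_seq_incr (sum_n a) M) as [l Hl].
- intros n. now apply sum_n_incr.
- exact HM.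
- exists l. exact Hl.
Qed.

Lemma ex_series_dominated (a b : nat -> R) :
  (forall k, 0 <= a k <= b k) -> ex_series b -> ex_series a.
Proof.
intros Hab. apply (ex_series_le (V := R_CompleteNormedModule)).
intros k. unfold norm; simpl. unfold abs; simpl.
rewrite Rabs_pos_eq; apply Hab.
Qed.

Lemma Series_nonneg (a : nat -> R) : (forall k, 0 <= a k) -> ex_series a -> 0 <= Series a.
Proof.
intros Ha Hex. apply Rle_trans with (sum_n a 0).
- rewrite sum_O. apply Ha.
- now apply sum_n_le_Series.
Qed.

Lemma sum_n_Rmult_l (c : R) (a : nat -> R) n : sum_n (fun k => c * a k) n = c * sum_n a n.
Proof. exact (sum_n_mult_l (K := R_Ring) c a n). Qed.

Lemma sum_n_Rle (a b : nat -> R) n :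
  (forall k, (k <= n)%nat -> a k <= b k) -> sum_n a n <= sum_n b n.
Proof.
induction n as [|n IH]; intros H.
- rewrite !sum_O. now apply H.
- rewrite !sum_Sn. apply Rplus_le_compat; [apply IH; intros; apply H; lia | now apply H].
Qed.

Lemma sum_n_S (a : nat -> R) n : sum_n a (S n) = sum_n a n + a (S n).
Proof. exact (sum_Sn a n). Qed.

(** * The Gamma function *)

Definition gamma_integrand (s t : R) : R := Rpower t (s - 1) * exp (- t).

Lemma gamma_integrand_pos s t : 0 < gamma_integrand s t.
Proof. apply Rmult_lt_0_compat; apply exp_pos. Qed.

Lemma gamma_integrand_continuous s t : 0 < t -> continuous (gamma_integrand s) t.
Proof.
intros Ht. apply (ex_derive_continuous (V := R_NormedModule)).
unfold gamma_integrand, Rpower. auto_derive. exact Ht.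
Qed.

Lemma gamma_integrand_ex_RInt s a b : 0 < a -> a <= b -> ex_RInt (gamma_integrand s) a b.
Proof.
intros Ha Hab. apply (ex_RInt_continuous (V := R_CompleteNormedModule)).
intros t Ht. apply gamma_integrand_continuous.
rewrite Rmin_left in Ht by lra. lra.
Qed.

Lemma Rpower_le_id t a : 1 <= t -> a <= 1 -> Rpower t a <= t.
Proof.
intros Ht Ha. rewrite <- (Rpower_1 t) at 2 by lra. apply Rle_Rpower; lra.
Qed.

Lemma Rpower_le_1 t a : 0 < t <= 1 -> 0 <= a -> Rpower t a <= 1.
Proof.
intros Ht Ha. unfold Rpower. rewrite <- exp_0.
assert (ln t <= 0) by (rewrite <- ln_1; apply ln_le; lra).
assert (a * ln t <= 0) by nra.
destruct (Req_dec (a * ln t) 0) as [-> | Hn]; [lra | left; apply exp_increasing; lra].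
Qed.

(** The exponent [s - 1] lies in [[0, 1]], so the power is at most [1 + t], and
    [(1 + t) * exp (- t)] has the primitive [- (2 + t) * exp (- t)], of total increment [2] on the
    half line. *)
Lemma gamma_integrand_RInt_le_2 s a b :
  1 <= s <= 2 -> 0 < a -> a <= b -> RInt (gamma_integrand s) a b <= 2.
Proof.
intros Hs Ha Hab.
assert (HI : is_RInt (fun t => (1 + t) * exp (- t)) a b
               (minus (- (2 + b) * exp (- b)) (- (2 + a) * exp (- a)))).
{ apply (is_RInt_derive (fun t => - (2 + t) * exp (- t))).
  - intros t _. auto_derive; [trivial | ring].
  - intros t _. apply (ex_derive_continuous (V := R_NormedModule)). auto_derive. trivial. }
apply Rle_trans with (RInt (fun t => (1 + t) * exp (- t)) a b).
- apply RInt_le; [lra | now apply gamma_integrand_ex_RInt | now exists (minus (- (2 + b) * exp (- b)) (- (2 + a) * exp (- a))) | ].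
  intros t Ht. apply Rmult_le_compat_r; [left; apply exp_pos | ].
  destruct (Rle_dec t 1).
  + pose proof (Rpower_le_1 t (s - 1)). lra.
  + pose proof (Rpower_le_id t (s - 1)). lra.
- rewrite (is_RInt_unique _ _ _ _ HI). unfold minus, plus, opp; simpl.
  assert (0 < exp (- b)) by apply exp_pos.
  assert (Ha1 : (1 + a) * exp (- a) <= 1).
  { pose proof (exp_ineq1 a). rewrite exp_Ropp. apply (Rmult_le_reg_r (exp a)); [apply exp_pos |].
    rewrite Rmult_assoc, Rinv_l by (apply Rgt_not_eq, exp_pos). lra. }
  assert (exp (- a) <= 1) by (rewrite <- exp_0; left; apply exp_increasing; lra).
  nra.
Qed.

(** Convergence and positivity of the value are bundled so that both pass through the induction on
    [s]. *)
Definition is_gamma (s l : R) : Prop :=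
  0 < l /\ is_RInt_gen (gamma_integrand s) (at_right 0) (Rbar_locally p_infty) l.

Lemma gamma_integrand_RInt_mono s a b a' b' :
  0 < a' -> a' <= a -> a <= b -> b <= b' ->
  RInt (gamma_integrand s) a b <= RInt (gamma_integrand s) a' b'.
Proof.
intros H0 H1 H2 H3.
rewrite <- (RInt_Chasles (gamma_integrand s) a' a b') by (apply gamma_integrand_ex_RInt; lra).
rewrite <- (RInt_Chasles (gamma_integrand s) a b b') by (apply gamma_integrand_ex_RInt; lra).
assert (P : forall x y, 0 < x -> x <= y -> 0 <= RInt (gamma_integrand s) x y).
{ intros x y Hx Hxy. apply RInt_ge_0; [lra | now apply gamma_integrand_ex_RInt |].
  intros; left; apply gamma_integrand_pos. }
unfold plus; simpl. pose proof (P a' a). pose proof (P b b'). lra.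
Qed.

(** The integrand is positive, so integrals over compact subintervals grow with the interval; their
    supremum is the improper integral. *)
Lemma is_gamma_base s : 1 <= s <= 2 -> exists l, is_gamma s l.
Proof.
intros Hs.
destruct (completeness (fun y => exists a b, 0 < a /\ a <= b /\ y = RInt (gamma_integrand s) a b))
  as [l [Hub Hleast]].
- exists 2. intros y (a & b & Ha & Hab & ->). now apply gamma_integrand_RInt_le_2.
- exists (RInt (gamma_integrand s) 1 2), 1, 2. repeat split; lra.
- exists l. split.
  + apply Rlt_le_trans with (RInt (gamma_integrand s) 1 2).
    * apply RInt_gt_0; [lra | intros; apply gamma_integrand_pos |].
      intros t Ht. apply gamma_integrand_continuous. lra.
    * apply Hub. exists 1, 2. repeat split; lra.
  + intros P [eps HP].
    assert (Hex : exists a b, 0 < a /\ a <= b /\ l - eps < RInt (gamma_integrand s) a b).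
    { apply Classical_Prop.NNPP. intros Hn.
      assert (l <= l - eps); [| destruct eps; simpl in *; lra].
      apply Hleast. intros y (a & b & Ha & Hab & ->).
      apply Rnot_lt_le. intros Hlt. apply Hn. now exists a, b. }
    destruct Hex as (a0 & b0 & Ha0 & Hab0 & Hl).
    apply (Filter_prod _ _ _ (fun a => 0 < a < a0) (fun b => b0 < b)).
    * exists (mkposreal a0 Ha0). intros a Ha Hpos. unfold ball in Ha; simpl in Ha.
      unfold AbsRing_ball, abs, minus, plus, opp in Ha; simpl in Ha.
      apply Rabs_def2 in Ha. lra.
    * now exists b0.
    * intros a b Ha Hb. exists (RInt (gamma_integrand s) a b). split.
      -- apply (RInt_correct (gamma_integrand s)). apply gamma_integrand_ex_RInt; simpl; lra.
      -- apply HP. change (Rabs (RInt (gamma_integrand s) a b - l) < eps).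
         assert (RInt (gamma_integrand s) a b <= l).
         { apply Hub. exists a, b. repeat split; lra. }
         assert (RInt (gamma_integrand s) a0 b0 <= RInt (gamma_integrand s) a b).
         { apply gamma_integrand_RInt_mono; lra. }
         apply Rabs_def1; destruct eps; simpl in *; lra.
Qed.

Lemma gamma_boundary_0 s : 1 <= s ->
  filterlim (fun t => - (Rpower t s * exp (- t))) (at_right 0) (locally 0).
Proof.
intros Hs P [eps HP].
assert (Hd : 0 < Rmin eps 1) by (apply Rmin_pos; [apply cond_pos | lra]).
exists (mkposreal _ Hd). intros t Ht Hpos. apply HP.
unfold ball in Ht; simpl in Ht.
unfold AbsRing_ball, abs, minus, plus, opp in Ht; simpl in Ht.
apply Rabs_def2 in Ht.
pose proof (Rmin_l eps 1). pose proof (Rmin_r eps 1).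
assert (0 < Rpower t s) by apply exp_pos.
assert (0 < exp (- t)) by apply exp_pos.
assert (exp (- t) < 1) by (rewrite <- exp_0; apply exp_increasing; lra).
assert (Rpower t s <= t).
{ replace s with (1 + (s - 1)) by ring. rewrite Rpower_plus, Rpower_1 by lra.
  pose proof (Rpower_le_1 t (s - 1)). nra. }
change (Rabs (- (Rpower t s * exp (- t)) - 0) < eps).
apply Rabs_def1; nra.
Qed.

(** The product is [exp (- t * (1 - s * (ln t / t)))] and [ln t / t] tends to [0], so the exponent
    tends to minus infinity. *)
Lemma gamma_boundary_p_infty s :
  filterlim (fun t => - (Rpower t s * exp (- t))) (Rbar_locally p_infty) (locally 0).
Proof.
assert (H : is_lim (fun t => - exp (- t * (1 - s * (ln t / t)))) p_infty (Rbar_opp 0)).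
{ apply is_lim_opp. apply (is_lim_comp exp _ p_infty 0 m_infty).
  - apply is_lim_exp_m.
  - replace m_infty with (Rbar_mult (Rbar_opp p_infty) (1 - s * 0)%R).
    + apply is_lim_mult.
      * apply is_lim_opp, is_lim_id.
      * apply is_lim_minus'; [apply is_lim_const |].
        apply (is_lim_scal_l (fun y => ln y / y) s p_infty 0). apply is_lim_div_ln_p.
      * simpl. lra.
    + simpl. rewrite Rmult_0_r, Rminus_0_r.
      destruct (Rle_dec 0 1) as [h|h]; [|lra].
      destruct (Rle_lt_or_eq_dec 0 1 h) as [h'|h']; [reflexivity | lra].
  - exists 0. intros; discriminate. }
simpl Rbar_opp in H. rewrite Ropp_0 in H.
apply (is_lim_ext_loc _ (fun t => - (Rpower t s * exp (- t)))) in H; [exact H |].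
exists 0. intros t Ht. f_equal. unfold Rpower. rewrite <- exp_plus. f_equal. field. lra.
Qed.

(** Integration by parts: [h] vanishes at both ends, so its derivative [h'], the difference of the
    two integrands, has improper integral [0]. *)
Lemma is_gamma_succ s l : 1 <= s -> is_gamma s l -> is_gamma (s + 1) (s * l).
Proof.
intros Hs [Hl HI]. split; [nra |].
pose (h := fun t => - (Rpower t s * exp (- t))).
pose (h' := fun t => gamma_integrand (s + 1) t - s * gamma_integrand s t).
assert (Hd : forall t, 0 < t -> is_derive h t (h' t)).
{ intros t Ht. unfold h, h', gamma_integrand.
  replace (s + 1 - 1) with s by ring.
  replace (Rpower t (s - 1)) with (Rpower t s / t)
    by (unfold Rminus; rewrite Rpower_plus, Rpower_Ropp, Rpower_1 by lra; reflexivity).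
  unfold Rpower. auto_derive; [exact Ht |]. field. lra. }
assert (Hbd : is_RInt_gen h' (at_right 0) (Rbar_locally p_infty) (0 - 0)).
{ apply is_RInt_gen_ext with (Derive h).
  - apply (Filter_prod _ _ _ (fun a => 0 < a) (fun b => 0 < b)).
    + exists (mkposreal 1 Rlt_0_1). intros; assumption.
    + now exists 0.
    + intros a b Ha Hb t Ht. apply is_derive_unique, Hd. simpl in Ht.
      pose proof (Rmin_pos a b Ha Hb). lra.
  - apply is_RInt_gen_Derive.
    + apply (Filter_prod _ _ _ (fun a => 0 < a) (fun b => 0 < b)).
      * exists (mkposreal 1 Rlt_0_1). intros; assumption.
      * now exists 0.
      * intros a b Ha Hb t Ht. exists (h' t). apply Hd. simpl in Ht.
        pose proof (Rmin_pos a b Ha Hb). lra.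
    + apply (Filter_prod _ _ _ (fun a => 0 < a) (fun b => 0 < b)).
      * exists (mkposreal 1 Rlt_0_1). intros; assumption.
      * now exists 0.
      * intros a b Ha Hb t Ht. simpl in Ht.
        pose proof (Rmin_pos a b Ha Hb). assert (Ht0 : 0 < t) by lra.
        apply (continuous_ext_loc _ h').
        -- exists (mkposreal t Ht0). intros y Hy. symmetry. apply is_derive_unique, Hd.
           change (Rabs (y - t) < t) in Hy. apply Rabs_def2 in Hy. lra.
        -- unfold h'. apply (continuous_minus (V := R_NormedModule)).
           ++ now apply gamma_integrand_continuous.
           ++ apply (continuous_scal_r (V := R_NormedModule)). now apply gamma_integrand_continuous.
    + now apply gamma_boundary_0.
    + apply gamma_boundary_p_infty. }
apply (is_RInt_gen_scal _ s) in HI.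
pose proof (is_RInt_gen_plus _ _ _ _ HI Hbd) as H.
replace (s * l) with (plus (scal s l) (0 - 0)) by (unfold plus, scal; simpl; unfold mult; simpl; ring).
revert H. apply is_RInt_gen_ext. apply filter_forall. intros ab t _.
unfold h', plus, scal; simpl. unfold mult; simpl. ring.
Qed.

(** The strip [[1, 2]] is treated directly and the functional equation climbs from there in unit
    steps. *)
Lemma is_gamma_Gamma s : 1 <= s -> is_gamma s (Gamma s).
Proof.
intros Hs.
assert (Hex : exists l, is_gamma s l).
{ destruct (nfloor_ex (s - 1)) as [n Hn]; [lra |].
  assert (H : 1 <= s <= INR n + 2) by lra. clear Hn Hs.
  revert s H. induction n as [|n IH]; intros s H.
  - apply is_gamma_base. simpl in H. lra.
  - destruct (Rle_dec s 2); [apply is_gamma_base; lra |].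
    rewrite S_INR in H. destruct (IH (s - 1)) as [l Hl]; [lra |].
    exists ((s - 1) * l). replace s with (s - 1 + 1) at 1 by ring.
    apply is_gamma_succ; [lra | exact Hl]. }
destruct Hex as [l Hl].
replace (Gamma s) with l; [exact Hl |].
symmetry. exact (is_RInt_gen_unique _ _ (proj2 Hl)).
Qed.

Lemma Gamma_pos s : 1 <= s -> 0 < Gamma s.
Proof. intros Hs. apply (is_gamma_Gamma s Hs). Qed.

Lemma Gamma_succ s : 1 <= s -> Gamma (s + 1) = s * Gamma s.
Proof.
intros Hs.
exact (is_RInt_gen_unique (gamma_integrand (s + 1)) _
         (proj2 (is_gamma_succ s (Gamma s) Hs (is_gamma_Gamma s Hs)))).
Qed.

(** * The recurrence of the modified Bessel functions *)

Definition bessel_term (v x : R) (n : nat) : R :=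
  Rpower x (2 * INR n + v) / (INR (fact n) * Gamma (INR n + v + 1)).

Lemma Gamma_shift_pos v n : 0 <= v -> 0 < Gamma (INR n + v + 1).
Proof. intros Hv. pose proof (pos_INR n). apply Gamma_pos. lra. Qed.

Lemma bessel_term_pos v x n : 0 <= v -> 0 < bessel_term v x n.
Proof.
intros Hv. apply Rdiv_lt_0_compat; [apply exp_pos |].
apply Rmult_lt_0_compat; [apply INR_fact_lt_0 | now apply Gamma_shift_pos].
Qed.

Lemma Gamma_shift_ge v n : 0 <= v -> Gamma (v + 1) <= Gamma (INR n + v + 1).
Proof.
intros Hv. induction n as [|n IH].
- simpl. right. f_equal. ring.
- rewrite S_INR. replace (INR n + 1 + v + 1) with (INR n + v + 1 + 1) by ring.
  pose proof (pos_INR n). rewrite (Gamma_succ (INR n + v + 1)) by lra.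
  pose proof (Gamma_shift_pos v n Hv).
  assert (0 <= (INR n + v) * Gamma (INR n + v + 1)) by (apply Rmult_le_pos; lra). lra.
Qed.

Lemma Rpower_even_shift x v n : 0 < x -> Rpower x (2 * INR n + v) = Rpower x v * (x * x) ^ n.
Proof.
intros Hx. rewrite Rpower_plus, Rmult_comm. f_equal.
rewrite <- Rpower_pow by nra.
rewrite <- (Rpower_mult x 2 (INR n)). f_equal.
replace 2 with (INR 2) by (simpl; ring). rewrite Rpower_pow by exact Hx. simpl. ring.
Qed.

(** The Gamma factor is at least its value at [n = 0], which leaves a multiple of the exponential
    series at [x * x]. *)
Lemma ex_series_bessel_term v x : 0 <= v -> 0 < x -> ex_series (bessel_term v x).
Proof.
intros Hv Hx.
apply (ex_series_le (V := R_CompleteNormedModule) _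
         (fun n => (Rpower x v / Gamma (v + 1)) * ((x * x) ^ n * / INR (fact n)))).
- intros n. unfold norm; simpl. unfold abs; simpl.
  rewrite Rabs_pos_eq by (left; now apply bessel_term_pos).
  unfold bessel_term. rewrite Rpower_even_shift by exact Hx.
  assert (0 < Gamma (v + 1)) by (apply Gamma_pos; lra).
  pose proof (Gamma_shift_ge v n Hv).
  pose proof (INR_fact_lt_0 n).
  assert (0 < Rpower x v) by apply exp_pos.
  assert (0 < (x * x) ^ n) by (apply pow_lt; nra).
  replace (Rpower x v / Gamma (v + 1) * ((x * x) ^ n * / INR (fact n)))
    with (Rpower x v * (x * x) ^ n / (INR (fact n) * Gamma (v + 1))) by (field; lra).
  apply Rmult_le_compat_l; [nra |]. apply Rinv_le_contravar; nra.
- apply (ex_series_scal_l (K := R_AbsRing) (V := R_NormedModule)). exists (exp (x * x)).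
  generalize (is_exp_Reals (x * x)). apply is_series_ext. intros n.
  rewrite pow_n_pow. reflexivity.
Qed.

Lemma BesselI_eq v z : BesselI v z = Series (bessel_term v (z / 2)).
Proof. reflexivity. Qed.

Lemma BesselI_pos v z : 0 <= v -> 0 < z -> 0 < BesselI v z.
Proof.
intros Hv Hz. rewrite BesselI_eq.
rewrite Series_incr_1 by (apply ex_series_bessel_term; lra).
pose proof (bessel_term_pos v (z / 2) 0 Hv).
assert (0 <= Series (fun k => bessel_term v (z / 2) (S k))); [| lra].
apply Series_nonneg.
- intros n. left. now apply bessel_term_pos.
- apply (ex_series_incr_1 (bessel_term v (z / 2))), ex_series_bessel_term; lra.
Qed.

(** The identity holds termwise after an index shift. In the difference [d] of the first two series
    the term of index [0] cancels by the functional equation of [Gamma], and the term of index [S n]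
    is the term of index [n] of the series of order [v + 2]. *)
Lemma BesselI_recurrence v z : 0 <= v -> 0 < z ->
  BesselI v z = 2 * (v + 1) / z * BesselI (v + 1) z + BesselI (v + 2) z.
Proof.
intros Hv Hz. rewrite !BesselI_eq. set (x := z / 2).
assert (Hx : 0 < x) by (unfold x; lra).
replace (2 * (v + 1) / z) with ((v + 1) / x) by (unfold x; field; lra).
pose (d := fun n => bessel_term v x n - (v + 1) / x * bessel_term (v + 1) x n).
assert (Hd0 : d 0%nat = 0).
{ unfold d, bessel_term. simpl. rewrite Rmult_0_r, !Rplus_0_l, Rpower_plus, Rpower_1 by exact Hx.
  rewrite (Gamma_succ (v + 1)) by lra. pose proof (Gamma_pos (v + 1)). field. lra. }
assert (HdS : forall n, d (S n) = bessel_term (v + 2) x n).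
{ intros n. unfold d, bessel_term.
  pose proof (pos_INR n). pose proof (INR_fact_lt_0 n).
  rewrite fact_simpl, mult_INR, !S_INR.
  replace (2 * (INR n + 1) + v) with (2 * INR n + (v + 2)) by ring.
  replace (2 * (INR n + 1) + (v + 1)) with (2 * INR n + (v + 2) + 1) by ring.
  rewrite (Rpower_plus (2 * INR n + (v + 2)) 1), Rpower_1 by exact Hx.
  replace (INR n + 1 + (v + 1) + 1) with (INR n + v + 2 + 1) by ring.
  replace (INR n + 1 + v + 1) with (INR n + v + 2) by ring.
  replace (INR n + (v + 2) + 1) with (INR n + v + 2 + 1) by ring.
  rewrite (Gamma_succ (INR n + v + 2)) by lra.
  pose proof (Gamma_pos (INR n + v + 2)). field. repeat split; lra. }
assert (E : Series d = Series (bessel_term v x) - (v + 1) / x * Series (bessel_term (v + 1) x)).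
{ unfold d. rewrite Series_minus, Series_scal_l; [reflexivity | now apply ex_series_bessel_term |].
  apply (ex_series_scal_l (K := R_AbsRing) (V := R_NormedModule)), ex_series_bessel_term; lra. }
assert (E' : Series d = Series (bessel_term (v + 2) x)).
{ rewrite Series_incr_1.
  - rewrite Hd0, Rplus_0_l. now apply Series_ext.
  - apply ex_series_incr_1. apply (ex_series_ext (bessel_term (v + 2) x)).
    + intros n. symmetry. apply HdS.
    + apply ex_series_bessel_term; lra. }
lra.
Qed.

(** * Ratios of consecutive eigenvalues *)

(** The Bessel recurrence at [v = k + d/2 - 1], where [2 (v + 1) = 2 k + d]. It is homogeneous in
    [w], so the prefactor of [lam] disappears. Positivity excludes the second solution, [K_v] with
    alternating signs, so that [w] is determined up to a factor. *)
Definition bessel_like (d : nat) (z : R) (w : nat -> R) : Prop :=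
  (2 <= d)%nat /\ 0 < z /\ (forall k, 0 < w k) /\
  forall k, z * w k = (2 * INR k + INR d) * w (S k) + z * w (S (S k)).

Lemma lam_bessel_like d tau : (2 <= d)%nat -> 0 < tau -> bessel_like d (2 / tau ^ 2) (lam d tau).
Proof.
intros Hd Htau. assert (Hz : 0 < 2 / tau ^ 2) by (apply Rdiv_lt_0_compat; [lra | now apply pow_lt]).
assert (HdR : 2 <= INR d) by (apply (le_INR 2) in Hd; simpl in Hd; lra).
assert (HA : 0 < exp (- 2 / tau ^ 2) * tau ^ (d - 2)).
{ apply Rmult_lt_0_compat; [apply exp_pos | now apply pow_lt]. }
assert (HG : 0 < Gamma (INR d / 2)) by (apply Gamma_pos; lra).
repeat split; [exact Hd | exact Hz | |]; intros k; unfold lam; pose proof (pos_INR k).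
- repeat apply Rmult_lt_0_compat; try apply exp_pos; [now apply pow_lt | | exact HG].
  apply BesselI_pos; lra.
- rewrite !S_INR. generalize dependent (2 / tau ^ 2). intros z Hz.
  replace (INR k + 1 + INR d / 2 - 1) with (INR k + INR d / 2 - 1 + 1) by ring.
  replace (INR k + 1 + 1 + INR d / 2 - 1) with (INR k + INR d / 2 - 1 + 2) by ring.
  rewrite (BesselI_recurrence (INR k + INR d / 2 - 1) z) by lra. field. lra.
Qed.

(* [w (S k) / w k <= z / (v + sqrt (v^2 + z^2))] with [v = k + d/2 - 1]. The recurrence
   transports this bound downwards from [k + 2] to [k], and for large [k] it is a
   consequence of [z w_k >= 2 (v + 1) w_(k+1)]. *)
Lemma bessel_like_ratio_le_sqrt d z w k : bessel_like d z w ->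
  let v := INR k + INR d / 2 - 1 in w (S k) * (v + sqrt (v * v + z * z)) <= z * w k.
Proof.
intros (Hd & Hz & Hw & Hrec).
assert (HdR : 2 <= INR d) by (apply (le_INR 2) in Hd; simpl in Hd; lra).
(* [n] counts the double steps from [k] up to a degree large enough for the base case, where
   [z * z <= 4 * k] forces the square root below [v + 2]. *)
assert (H : forall n k, z * z <= 4 * INR (k + 2 * n) -> let v := INR k + INR d / 2 - 1 in
   w (S k) * (v + sqrt (v * v + z * z)) <= z * w k).
{ clear k. induction n as [|n IH]; intros k Hk v.
  - rewrite Nat.mul_0_r, Nat.add_0_r in Hk. rewrite Hrec.
    assert (0 <= v) by (unfold v; pose proof (pos_INR k); lra).
    assert (sqrt (v * v + z * z) <= v + 2).
    { rewrite <- (sqrt_square (v + 2)) by lra. apply sqrt_le_1_alt. unfold v in *. nra. }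
    pose proof (Hw (S k)). pose proof (Hw (S (S k))).
    replace (2 * INR k + INR d) with (v + (v + 2)) by (unfold v; lra). nra.
  - assert (Hk2 : z * z <= 4 * INR (S (S k) + 2 * n)) by (replace (S (S k) + 2 * n)%nat with (k + 2 * S n)%nat by lia; exact Hk).
    specialize (IH (S (S k)) Hk2). cbv zeta in IH.
    rewrite !S_INR in IH. replace (INR k + 1 + 1 + INR d / 2 - 1) with (v + 2) in IH by (unfold v; ring).
    assert (Hv : 0 <= v) by (unfold v; pose proof (pos_INR k); lra).
    set (s := sqrt ((v + 2) * (v + 2) + z * z)) in *.
    assert (Hs : s * s = (v + 2) * (v + 2) + z * z) by (apply sqrt_sqrt; nra).
    assert (Hs0 : 0 <= s) by apply sqrt_pos.
    assert (Hvs : sqrt (v * v + z * z) <= s) by (apply sqrt_le_1_alt; nra).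
    pose proof (Hrec k) as R0. pose proof (Hrec (S k)) as R1. rewrite S_INR in R1.
    replace (2 * INR k + INR d) with (2 * (v + 1)) in R0 by (unfold v; field).
    replace (2 * (INR k + 1) + INR d) with (2 * (v + 2)) in R1 by (unfold v; field).
    pose proof (Hw k). pose proof (Hw (S k)) as H1. pose proof (Hw (S (S k))) as H2.
    set (a := w (S k)) in *. set (b := w (S (S k))) in *. set (c := w (S (S (S k)))) in *.
    (* The upper bound on [c / b] turns into a lower bound on [b / a] by the recurrence at [S k],
       and then into an upper bound on [a / w k] by the recurrence at [k]. The identity
       [s * s - (v + 2) * (v + 2) = z * z] makes both inversions exact. *)
    assert (L : z * a <= (v + 2 + s) * b).
    { apply (Rmult_le_reg_r (v + 2 + s)); [lra |]. rewrite R1.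
      replace ((v + 2 + s) * b * (v + 2 + s))
        with (b * (2 * (v + 2) * (v + 2 + s) + (s * s - (v + 2) * (v + 2)))) by ring.
      rewrite Hs. apply Rle_trans with (2 * (v + 2) * b * (v + 2 + s) + z * (c * (v + 2 + s))); [right; ring |].
      apply Rle_trans with (2 * (v + 2) * b * (v + 2 + s) + z * (z * b)); [| right; ring].
      apply Rplus_le_compat_l, Rmult_le_compat_l; lra. }
    apply Rle_trans with (a * (v + s)); [apply Rmult_le_compat_l; lra |].
    rewrite R0. assert (a * (s - (v + 2)) <= z * b); [| nra].
    apply (Rmult_le_reg_r (v + 2 + s)); [lra |].
    replace (a * (s - (v + 2)) * (v + 2 + s)) with (a * (s * s - (v + 2) * (v + 2))) by ring.
    rewrite Hs. replace (a * ((v + 2) * (v + 2) + z * z - (v + 2) * (v + 2))) with (z * (z * a)) by ring.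
    rewrite Rmult_assoc. apply Rmult_le_compat_l; lra. }
destruct (nfloor_ex (z * z)) as [n [_ Hn]]; [nra |].
apply (H (S n) k). rewrite plus_INR, mult_INR, !S_INR, INR_0. pose proof (pos_INR k). pose proof (pos_INR n). lra.
Qed.

Section BesselLike.

Context (d : nat) (z : R) (w : nat -> R) (Hw : bessel_like d z w).

Lemma bessel_like_pos k : 0 < w k.
Proof. apply Hw. Qed.

(** Here [v >= k] because [d >= 2], and the square root is at least [z]. Rearranged, this is
    [w k * k <= (k + z) * (w k - w (S k))], the form that summation by parts consumes. *)
Lemma bessel_like_ratio_le k : w (S k) * (INR k + z) <= z * w k.
Proof.
destruct Hw as (Hd & Hz & Hpos & _).
apply (le_INR 2) in Hd. simpl in Hd. pose proof (pos_INR k).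
eapply Rle_trans; [| exact (bessel_like_ratio_le_sqrt d z w k Hw)].
apply Rmult_le_compat_l; [left; apply Hpos |].
set (v := INR k + INR d / 2 - 1). assert (z <= sqrt (v * v + z * z)).
{ rewrite <- (sqrt_square z) at 1 by lra. apply sqrt_le_1_alt. nra. }
unfold v in *. lra.
Qed.

Lemma bessel_like_decr k : w (S k) <= w k.
Proof.
pose proof (bessel_like_ratio_le k). pose proof (pos_INR k). pose proof (bessel_like_pos (S k)).
destruct Hw as (_ & Hz & _). apply (Rmult_le_reg_l z); [exact Hz | nra].
Qed.

Lemma bessel_like_antitone j k : (j <= k)%nat -> w k <= w j.
Proof.
induction 1 as [|k _ IH]; [lra |]. pose proof (bessel_like_decr k). lra.
Qed.

(** Monotonicity turns the recurrence into [w k <= (1 + (2 k + d) / z) * w (S k)]. With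
    [1 + y <= exp y] the exponents add up, and the sum of [2 j + d] over [j < k] is at most
    [k^2 + d k]. *)
Lemma bessel_like_ge k : w 0%nat * exp (- ((INR k ^ 2 + INR d * INR k) / z)) <= w k.
Proof.
destruct Hw as (Hd & Hz & Hpos & Hrec).
induction k as [|k IH].
- simpl. replace (- ((0 * (0 * 1) + INR d * 0) / z)) with 0 by (field; lra). rewrite exp_0. lra.
- pose proof (pos_INR k). pose proof (pos_INR d).
  set (y := (2 * INR k + INR d) / z).
  assert (Hy : 0 <= y) by (apply Rmult_le_pos; [lra | left; now apply Rinv_0_lt_compat]).
  assert (Hstep : w k <= exp y * w (S k)).
  { apply Rle_trans with ((1 + y) * w (S k)).
    - apply (Rmult_le_reg_l z); [exact Hz |]. rewrite Hrec.
      replace (z * ((1 + y) * w (S k))) with ((2 * INR k + INR d) * w (S k) + z * w (S k)) by (unfold y; field; lra).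
      pose proof (bessel_like_decr (S k)). nra.
    - apply Rmult_le_compat_r; [left; apply Hpos | apply exp_ineq1_le]. }
  apply (Rmult_le_reg_l (exp y)); [apply exp_pos |].
  apply Rle_trans with (w k); [| exact Hstep].
  apply Rle_trans with (2 := IH).
  replace (exp y * (w 0%nat * exp (- ((INR (S k) ^ 2 + INR d * INR (S k)) / z))))
    with (w 0%nat * (exp y * exp (- ((INR (S k) ^ 2 + INR d * INR (S k)) / z)))) by ring.
  apply Rmult_le_compat_l; [left; apply Hpos |].
  rewrite <- exp_plus.
  replace (y + - ((INR (S k) ^ 2 + INR d * INR (S k)) / z))
    with (- ((INR k ^ 2 + INR d * INR k) / z) - / z) by (rewrite S_INR; unfold y; field; lra).
  left. apply exp_increasing. pose proof (Rinv_0_lt_compat z Hz). lra.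
Qed.

End BesselLike.

(** * Multiplicities and summation by parts *)

Lemma fact_add_ge k p : (fact k * (k + 1) ^ p <= fact (k + p))%nat.
Proof.
induction p as [|p IH]; [rewrite Nat.add_0_r; simpl; lia |].
rewrite (Nat.add_succ_r k p), fact_simpl, Nat.pow_succ_r'. nia.
Qed.

Lemma fact_add_le k p : (fact (k + p) <= fact k * (k + 1) ^ p * fact p)%nat.
Proof.
induction p as [|p IH]; [rewrite Nat.add_0_r; simpl; lia |].
rewrite (Nat.add_succ_r k p), !fact_simpl, Nat.pow_succ_r'.
apply Nat.le_trans with (((k + 1) * S p) * (fact k * (k + 1) ^ p * fact p))%nat; [| apply Nat.eq_le_incl; ring].
apply Nat.mul_le_mono; [nia | exact IH].
Qed.

Lemma fact_mul_le k p : (fact k * fact p <= fact (k + p))%nat.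
Proof.
induction p as [|p IH]; [rewrite Nat.add_0_r; simpl; lia |].
rewrite (Nat.add_succ_r k p), !fact_simpl. nia.
Qed.

(** Up to a factor between [1] and [2], the quotient is the binomial coefficient
    [(k + p)! / (k! p!)], of order [k^p]. *)
Lemma Nmult_bounds p k :
  (Nmult (p + 2) k <= 2 * (k + 1) ^ p /\ (k + 1) ^ p <= 2 * fact p * Nmult (p + 2) k)%nat.
Proof.
pose proof (lt_O_fact p) as Hp.
destruct k as [|k].
- simpl. rewrite Nat.pow_1_l. lia.
- unfold Nmult.
  replace (2 * S k + (p + 2) - 2)%nat with (2 * S k + p)%nat by lia.
  replace (S k + (p + 2) - 3)%nat with (k + p)%nat by lia.
  replace (p + 2 - 2)%nat with p by lia.
  set (A := ((2 * S k + p) * fact (k + p))%nat).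
  set (D := (fact (S k) * fact p)%nat).
  assert (HD : (0 < D)%nat) by (unfold D; pose proof (lt_O_fact (S k)); nia).
  assert (Hf : fact (S k + p) = ((S k + p) * fact (k + p))%nat) by reflexivity.
  pose proof (fact_add_ge (S k) p) as Hge. pose proof (fact_add_le (S k) p) as Hle.
  pose proof (lt_O_fact (k + p)).
  assert (HA1 : (fact (S k + p) <= A)%nat) by (rewrite Hf; unfold A; nia).
  assert (HA2 : (A <= 2 * fact (S k + p))%nat) by (rewrite Hf; unfold A; nia).
  set (Q := ((S k + 1) ^ p)%nat) in *.
  split.
  + apply Nat.le_trans with ((2 * Q * D) / D)%nat; [| rewrite Nat.div_mul; lia].
    apply Nat.Div0.div_le_mono. unfold D. nia.
  + pose proof (Nat.div_mod_eq A D) as HE. pose proof (Nat.mod_upper_bound A D).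
    set (q := (A / D)%nat) in *.
    (* The floor only yields a bound by [q + 1]; since [q >= 1] this is at most [2 * q], whence the
       factor [2] in the lower bound. *)
    assert (Hq : (1 <= q)%nat).
    { apply Nat.div_le_lower_bound; [lia |]. rewrite Nat.mul_1_r.
      apply Nat.le_trans with (2 := HA1). apply fact_mul_le. }
    assert (Hlt : (fact (S k) * Q < fact (S k) * (fact p * (q + 1)))%nat) by (unfold D in *; nia).
    apply Nat.mul_lt_mono_pos_l in Hlt; [| apply lt_O_fact]. nia.
Qed.

(** Discrete form of [(y^p)' = p y^(p-1)]: the relative increment is at most [p / (y + 1)]. *)
Lemma pow_succ_diff_le y p : 0 <= y -> (y + 1) * ((y + 1) ^ p - y ^ p) <= INR p * (y + 1) ^ p.
Proof.
intros Hy. induction p as [|p IH]; [simpl; lra |].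
rewrite S_INR. simpl.
apply Rle_trans with ((y + 1) * (INR p * (y + 1) ^ p + (y + 1) ^ p)); [| right; ring].
replace ((y + 1) * ((y + 1) * (y + 1) ^ p - y * y ^ p))
  with ((y + 1) * ((y + 1) * ((y + 1) ^ p - y ^ p) + y ^ p)) by ring.
apply Rmult_le_compat_l; [lra |]. apply Rplus_le_compat; [exact IH |].
apply pow_incr. lra.
Qed.

Lemma sum_pow_le p n : sum_n (fun k => (INR k + 1) ^ p) n <= (INR n + 1) ^ (S p).
Proof.
induction n as [|n IH].
- rewrite sum_O, INR_0, Rplus_0_l, !pow1. lra.
- rewrite sum_Sn, S_INR. unfold plus; simpl. simpl in IH.
  pose proof (pos_INR n).
  assert ((INR n + 1) ^ p <= (INR n + 1 + 1) ^ p) by (apply pow_incr; lra).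
  assert ((INR n + 1) * (INR n + 1) ^ p <= (INR n + 1) * (INR n + 1 + 1) ^ p) by (apply Rmult_le_compat_l; lra).
  lra.
Qed.

Lemma sum_pow_ge p n : (INR n + 1) ^ (S p) <= INR (S p) * sum_n (fun k => (INR k + 1) ^ p) n.
Proof.
induction n as [|n IH].
- rewrite sum_O, INR_0, Rplus_0_l, !pow1, S_INR. pose proof (pos_INR p). lra.
- rewrite sum_n_S. rewrite Rmult_plus_distr_l.
  pose proof (pos_INR n). rewrite (S_INR n).
  pose proof (pow_succ_diff_le (INR n + 1) (S p)) as H1.
  assert (0 < INR n + 1 + 1) by lra.
  assert ((INR n + 1 + 1) ^ S p - (INR n + 1) ^ S p <= INR (S p) * (INR n + 1 + 1) ^ p); [| lra].
  apply (Rmult_le_reg_l (INR n + 1 + 1)); [assumption |].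
  apply Rle_trans with (1 := H1 ltac:(lra)). right. simpl. ring.
Qed.

(* Summation by parts: the weight [(k + 1)^p (1 + z / k)] has relative increments
   of order [p (1 + z / k) / k <= 2 p / B] beyond [k1], and the terms before [k1] are
   counted trivially. *)
Lemma sum_pow_mul_le p z B A (a b : nat -> R) k1 n :
  0 <= z -> 1 <= B -> B <= INR k1 -> B * z <= INR k1 ^ 2 ->
  (forall k, 0 <= a k <= A) -> (forall k, a (S k) <= a k) -> (forall k, b k <= A) ->
  (forall k, b k * INR k <= (INR k + z) * (a k - a (S k))) ->
  sum_n (fun k => (INR k + 1) ^ p * b k) n <=
    2 * A * (INR k1 + 1) ^ (S p) + 2 * INR p / B * sum_n (fun k => (INR k + 1) ^ p * a k) n.
Proof.
intros Hz HB Hk1 Hk1z Ha Hdec HbA Hb.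
set (P := fun k : nat => (INR k + 1) ^ p).
change (sum_n (fun k => P k * b k) n <=
  2 * A * (INR k1 + 1) ^ (S p) + 2 * INR p / B * sum_n (fun k => P k * a k) n).
assert (HP : forall k, 0 < P k) by (intros k; apply pow_lt; pose proof (pos_INR k); lra).
assert (HA : 0 <= A) by (pose proof (Ha 0%nat); lra).
assert (Hp : 0 <= 2 * INR p / B).
{ pose proof (pos_INR p). apply Rmult_le_pos; [lra | left; apply Rinv_0_lt_compat; lra]. }
assert (HS : forall m, 0 <= 2 * INR p / B * sum_n (fun k => P k * a k) m).
{ intros m. apply Rmult_le_pos; [exact Hp |].
  rewrite <- (Rmult_0_r (INR (S m))), <- (sum_n_const m 0).
  apply sum_n_Rle. intros k _. apply Rmult_le_pos; [left; apply HP | apply Ha]. }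
assert (Hhead : forall m, sum_n (fun k => P k * b k) m <= A * (INR m + 1) ^ (S p)).
{ intros m. apply Rle_trans with (A * sum_n P m).
  - rewrite <- sum_n_Rmult_l. apply sum_n_Rle. intros k _. rewrite Rmult_comm.
    apply Rmult_le_compat_r; [left; apply HP | apply HbA].
  - apply Rmult_le_compat_l; [exact HA | apply sum_pow_le]. }
assert (Hmono : forall m, (m <= k1)%nat -> A * (INR m + 1) ^ (S p) <= A * (INR k1 + 1) ^ (S p)).
{ intros m Hm. apply Rmult_le_compat_l; [exact HA |]. apply pow_incr.
  pose proof (pos_INR m). apply le_INR in Hm. lra. }
assert (HQ : 0 <= A * (INR k1 + 1) ^ S p).
{ apply Rmult_le_pos; [exact HA | apply pow_le; lra]. }
set (c := fun k : nat => 1 + z / INR k).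
(* From [B * z <= k1^2 <= k^2] follows [z / k <= k / B], and [1 <= k / B]; this is where both
   conditions on the cutoff are used. *)
assert (Hc : forall k, (k1 <= k)%nat -> b k <= c k * (a k - a (S k)) /\ 0 < c k /\ c k <= 1 + INR k /\ c k <= 2 * INR k / B).
{ intros k Hk. apply le_INR in Hk. assert (Hk0 : 0 < INR k) by lra.
  assert (Hik : 0 < / INR k) by now apply Rinv_0_lt_compat.
  assert (Hzk : B * (z / INR k) <= INR k).
  { apply (Rmult_le_reg_r (INR k)); [exact Hk0 |].
    replace (B * (z / INR k) * INR k) with (B * z) by (field; lra). nra. }
  assert (0 <= z / INR k) by (apply Rmult_le_pos; lra).
  repeat split; unfold c.
  - apply (Rmult_le_reg_r (INR k)); [exact Hk0 |].
    replace ((1 + z / INR k) * (a k - a (S k)) * INR k) with ((INR k + z) * (a k - a (S k))) by (field; lra).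
    apply Hb.
  - lra.
  - nra.
  - apply (Rmult_le_reg_r B); [lra |].
    replace (2 * INR k / B * B) with (2 * INR k) by (field; lra). nra. }
(* The boundary term of the summation by parts stays on the left and is dropped at the end. Of the
   two copies of [A * (k1 + 1)^(p + 1)], one pays for the degrees below [k1], the other for the
   boundary term created at [k1]. *)
assert (Hinv : forall j, sum_n (fun k => P k * b k) (k1 + j) + P (k1 + j)%nat * c (k1 + j)%nat * a (S (k1 + j)) <=
   2 * A * (INR k1 + 1) ^ (S p) + 2 * INR p / B * sum_n (fun k => P k * a k) (k1 + j)).
{ induction j as [|j IH].
  - rewrite Nat.add_0_r. pose proof (HS k1) as HSk. destruct k1 as [|k0]; [simpl in Hk1; lra |].
    rewrite (sum_n_S (fun k => P k * b k)).
    destruct (Hc (S k0) (Nat.le_refl _)) as (H1 & H2 & H3 & _).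
    pose proof (Hhead k0). pose proof (Hmono k0 ltac:(lia)).
    pose proof (HP (S k0)) as HPk. pose proof (Ha (S k0)).
    assert (E : P (S k0) * (INR (S k0) + 1) = (INR (S k0) + 1) ^ S p) by (unfold P; simpl; ring).
    assert (P (S k0) * b (S k0) <= P (S k0) * (c (S k0) * (a (S k0) - a (S (S k0))))) by (apply Rmult_le_compat_l; lra).
    assert (P (S k0) * (c (S k0) * a (S k0)) <= P (S k0) * ((INR (S k0) + 1) * A)).
    { apply Rmult_le_compat_l; [lra |]. apply Rmult_le_compat; lra. }
    nra.
  - rewrite Nat.add_succ_r. set (m := (k1 + j)%nat) in *.
    rewrite !sum_n_S.
    destruct (Hc m ltac:(unfold m; lia)) as (_ & Hcm & _ & _).
    destruct (Hc (S m) ltac:(unfold m; lia)) as (H1 & H2 & _ & H4).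
    pose proof (HP m) as HPm. pose proof (HP (S m)) as HPSm. pose proof (Ha (S m)) as HaS.
    assert (P (S m) * b (S m) <= P (S m) * (c (S m) * (a (S m) - a (S (S m))))) by (apply Rmult_le_compat_l; lra).
    assert (Hcdec : c (S m) <= c m).
    { unfold c. apply Rplus_le_compat_l, Rmult_le_compat_l; [exact Hz |].
      assert (INR k1 <= INR m) by (apply le_INR; unfold m; lia).
      rewrite S_INR. apply Rinv_le_contravar; lra. }
    assert (Hm : INR k1 <= INR m) by (apply le_INR; unfold m; lia).
    assert (Hdiff : (P (S m) - P m) * (INR (S m) + 1) <= INR p * P (S m)).
    { unfold P. rewrite Rmult_comm, S_INR. pose proof (pow_succ_diff_le (INR m + 1) p). lra. }
    assert (HdP : 0 <= P (S m) - P m).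
    { assert (P m <= P (S m)); [| lra]. unfold P. apply pow_incr. rewrite S_INR. lra. }
    assert (Hinc : (P (S m) - P m) * c (S m) <= 2 * INR p / B * P (S m)).
    { apply Rle_trans with ((P (S m) - P m) * (2 * INR (S m) / B)); [apply Rmult_le_compat_l; lra |].
      apply (Rmult_le_reg_r B); [lra |].
      replace ((P (S m) - P m) * (2 * INR (S m) / B) * B) with (2 * ((P (S m) - P m) * INR (S m))) by (field; lra).
      replace (2 * INR p / B * P (S m) * B) with (2 * (INR p * P (S m))) by (field; lra). nra. }
    assert ((P (S m) * c (S m) - P m * c m) * a (S m) <= 2 * INR p / B * P (S m) * a (S m)).
    { apply Rmult_le_compat_r; [lra |]. apply Rle_trans with (2 := Hinc). nra. }
    nra. }
destruct (Nat.le_gt_cases k1 n) as [Hn | Hn].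
- replace n with (k1 + (n - k1))%nat by lia.
  apply Rle_trans with (2 := Hinv (n - k1)%nat).
  destruct (Hc (k1 + (n - k1))%nat ltac:(lia)) as (_ & H2 & _ & _).
  assert (0 <= P (k1 + (n - k1))%nat * c (k1 + (n - k1))%nat * a (S (k1 + (n - k1)))); [| lra].
  apply Rmult_le_pos; [| apply Ha].
  apply Rmult_le_pos; [left; apply HP | lra].
- apply Rle_trans with (1 := Hhead n). pose proof (HS n). pose proof (Hmono n ltac:(lia)). lra.
Qed.

(** * Effective degrees of freedom *)

(** Chosen so that [(K + 1)^(d - 1)] is at most this constant times the number of eigenfunctions of
    degree at most [K]: [2 (d - 2)!] comes from the multiplicities, [d - 1] from summing powers. *)
Definition count_const (d : nat) : R := 2 * INR (fact (d - 2)) * INR (d - 1).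

Lemma INR_Nmult_le d k : (2 <= d)%nat -> INR (Nmult d k) <= 2 * (INR k + 1) ^ (d - 2).
Proof.
intros Hd. replace d with (d - 2 + 2)%nat at 1 by lia.
destruct (Nmult_bounds (d - 2) k) as [H _]. apply le_INR in H.
rewrite mult_INR, pow_INR, plus_INR in H. exact H.
Qed.

Lemma INR_Nmult_ge d k : (2 <= d)%nat ->
  (INR k + 1) ^ (d - 2) <= 2 * INR (fact (d - 2)) * INR (Nmult d k).
Proof.
intros Hd. replace d with (d - 2 + 2)%nat at 3 by lia.
destruct (Nmult_bounds (d - 2) k) as [_ H]. apply le_INR in H.
rewrite !mult_INR, pow_INR, plus_INR in H. exact H.
Qed.

Lemma count_const_pos d : (2 <= d)%nat -> 0 < count_const d.
Proof.
intros Hd. unfold count_const. repeat apply Rmult_lt_0_compat; [lra | apply INR_fact_lt_0 |].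
apply lt_0_INR. lia.
Qed.

Lemma pow_le_sum_Nmult d K : (2 <= d)%nat ->
  (INR K + 1) ^ (d - 1) <= count_const d * sum_n (fun k => INR (Nmult d k)) K.
Proof.
intros Hd. unfold count_const. replace (d - 1)%nat with (S (d - 2)) by lia.
apply Rle_trans with (1 := sum_pow_ge (d - 2) K).
replace (2 * INR (fact (d - 2)) * INR (S (d - 2)) * sum_n (fun k => INR (Nmult d k)) K)
  with (INR (S (d - 2)) * (2 * INR (fact (d - 2)) * sum_n (fun k => INR (Nmult d k)) K)) by ring.
apply Rmult_le_compat_l; [apply pos_INR |].
rewrite <- sum_n_Rmult_l. apply sum_n_Rle. intros k _. now apply INR_Nmult_ge.
Qed.

Lemma ratio_bounds w k : 0 < w -> 0 < k -> 0 < w / (w + k) < 1.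
Proof.
intros Hw Hk. split; [apply Rdiv_lt_0_compat; lra |].
apply (Rmult_lt_reg_r (w + k)); [lra |]. replace (w / (w + k) * (w + k)) with w by (field; lra). lra.
Qed.

Lemma ratio_mono w w' k k' : 0 < w -> w <= w' -> 0 < k' -> k' <= k -> w / (w + k) <= w' / (w' + k').
Proof.
intros H1 H2 H3 H4. apply (Rmult_le_reg_r ((w + k) * (w' + k'))); [nra |].
replace (w / (w + k) * ((w + k) * (w' + k'))) with (w * (w' + k')) by (field; lra).
replace (w' / (w' + k') * ((w + k) * (w' + k'))) with (w' * (w + k)) by (field; lra).
nra.
Qed.

Lemma ratio_le_div w k : 0 < w -> 0 < k -> w / (w + k) <= w / k.
Proof.
intros Hw Hk. apply Rmult_le_compat_l; [lra |]. apply Rinv_le_contravar; lra.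
Qed.

Section Spectrum.

Context (d : nat) (z : R) (w : nat -> R) (Hw : bessel_like d z w).

Notation N k := (INR (Nmult d k)).
Notation L kappa k := (w k / (w k + kappa)).
Notation dof kappa := (Series (fun k => N k * L kappa k)).

Let Hd : (2 <= d)%nat := proj1 Hw.
Let Hz : 0 < z := proj1 (proj2 Hw).
Let wpos := bessel_like_pos d z w Hw.

(** [sum_pow_mul_le] is applied with [a] and [b] both equal to [w]. Taking [B = 4 (d - 2) + 1]
    brings the coefficient of the sum on the right below [1/2], so it is absorbed on the left;
    doubling for this and for the multiplicities turns [2] into [8]. *)
Lemma trace_sum_le k1 n :
  4 * INR (d - 2) + 1 <= INR k1 -> (4 * INR (d - 2) + 1) * z <= INR k1 ^ 2 ->
  sum_n (fun k => N k * w k) n <= 8 * w 0%nat * (INR k1 + 1) ^ (d - 1).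
Proof.
intros H1 H2. pose proof (pos_INR (d - 2)) as Hp.
assert (Hdec : forall k, 0 <= w k <= w 0%nat).
{ intros k. split; [left; apply wpos | apply (bessel_like_antitone d z w Hw); lia]. }
assert (H := sum_pow_mul_le (d - 2) z (4 * INR (d - 2) + 1) (w 0%nat) w w k1 n
  ltac:(lra) ltac:(lra) H1 H2 Hdec (bessel_like_decr d z w Hw) (fun k => proj2 (Hdec k))).
replace (S (d - 2)) with (d - 1)%nat in H by lia.
assert (HS : 0 <= sum_n (fun k => (INR k + 1) ^ (d - 2) * w k) n).
{ rewrite <- (Rmult_0_r (INR (S n))), <- (sum_n_const n 0). apply sum_n_Rle. intros k _.
  apply Rmult_le_pos; [apply pow_le; pose proof (pos_INR k); lra | apply Hdec]. }
assert (Hhalf : 2 * INR (d - 2) / (4 * INR (d - 2) + 1) <= / 2).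
{ apply (Rmult_le_reg_r (4 * INR (d - 2) + 1)); [lra |].
  replace (2 * INR (d - 2) / (4 * INR (d - 2) + 1) * (4 * INR (d - 2) + 1)) with (2 * INR (d - 2)) by (field; lra). lra. }
assert (Hstep : forall k, w k * INR k <= (INR k + z) * (w k - w (S k))).
{ intros k. pose proof (bessel_like_ratio_le d z w Hw k). lra. }
specialize (H Hstep).
assert (sum_n (fun k => N k * w k) n <= 2 * sum_n (fun k => (INR k + 1) ^ (d - 2) * w k) n).
{ rewrite <- sum_n_Rmult_l. apply sum_n_Rle. intros k _. rewrite <- Rmult_assoc.
  apply Rmult_le_compat_r; [apply Hdec | now apply INR_Nmult_le]. }
pose proof (Rmult_le_compat_r _ _ _ HS Hhalf). lra.
Qed.

Lemma exists_cutoff B : 0 <= B -> exists k1, B <= INR k1 /\ B * z <= INR k1 ^ 2.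
Proof.
intros HB. destruct (nfloor_ex (B + z + 1)) as [n [_ Hn]]; [lra |].
exists (S n). rewrite S_INR. pose proof (pos_INR n). split; nra.
Qed.

Lemma trace_ex_series : ex_series (fun k => N k * w k).
Proof.
destruct (exists_cutoff (4 * INR (d - 2) + 1)) as (k1 & H1 & H2).
- pose proof (pos_INR (d - 2)). lra.
- apply ex_series_of_bounded with (8 * w 0%nat * (INR k1 + 1) ^ (d - 1)).
  + intros k. apply Rmult_le_pos; [apply pos_INR | left; apply wpos].
  + intros n. now apply trace_sum_le.
Qed.

Section Kappa.

Context (kappa : R) (Hkappa : 0 < kappa).

Lemma dof_term_bounds k : 0 <= N k * L kappa k <= / kappa * (N k * w k).
Proof.
pose proof (ratio_bounds (w k) kappa (wpos k) Hkappa). pose proof (pos_INR (Nmult d k)).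
split; [apply Rmult_le_pos; lra |].
replace (/ kappa * (N k * w k)) with (N k * (w k / kappa)) by (field; lra).
apply Rmult_le_compat_l; [lra |]. apply ratio_le_div; [apply wpos | exact Hkappa].
Qed.

Lemma dof_ex_series : ex_series (fun k => N k * L kappa k).
Proof.
apply ex_series_dominated with (fun k => / kappa * (N k * w k)).
- apply dof_term_bounds.
- apply (ex_series_scal_l (K := R_AbsRing) (V := R_NormedModule)), trace_ex_series.
Qed.

Lemma dof_le_trace : dof kappa <= Series (fun k => N k * w k) / kappa.
Proof.
unfold Rdiv. rewrite Rmult_comm, <- Series_scal_l. apply Series_le; [apply dof_term_bounds |].
apply (ex_series_scal_l (K := R_AbsRing) (V := R_NormedModule)), trace_ex_series.
Qed.

Lemma filter_antitone j k : (j <= k)%nat -> L kappa k <= L kappa j.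
Proof.
intros Hjk. apply ratio_mono; [apply wpos | now apply (bessel_like_antitone d z w Hw) | exact Hkappa | lra].
Qed.

(** The filter decreases with the degree, so each eigenfunction of degree at most [K] contributes at
    least the filter value at [K]. *)
Lemma count_filter_le_dof K : (INR K + 1) ^ (d - 1) * L kappa K <= count_const d * dof kappa.
Proof.
pose proof (ratio_bounds (w K) kappa (wpos K) Hkappa).
apply Rle_trans with (count_const d * (sum_n (fun k => N k) K * L kappa K)).
- rewrite <- Rmult_assoc. apply Rmult_le_compat_r; [lra |]. now apply pow_le_sum_Nmult.
- apply Rmult_le_compat_l; [left; now apply count_const_pos |].
  apply Rle_trans with (sum_n (fun k => N k * L kappa k) K).
  + rewrite Rmult_comm, <- sum_n_Rmult_l. apply sum_n_Rle. intros k Hk. rewrite Rmult_comm.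
    apply Rmult_le_compat_l; [apply pos_INR | now apply filter_antitone].
  + apply sum_n_le_Series; [intros; apply dof_term_bounds | apply dof_ex_series].
Qed.

Lemma sq_term_bounds k : 0 <= N k * L kappa k ^ 2 <= L kappa 0%nat * (N k * L kappa k).
Proof.
pose proof (ratio_bounds (w k) kappa (wpos k) Hkappa). pose proof (pos_INR (Nmult d k)).
pose proof (filter_antitone 0 k ltac:(lia)).
split; [apply Rmult_le_pos; [lra | apply pow2_ge_0] |].
replace (L kappa 0%nat * (N k * L kappa k)) with (N k * (L kappa 0%nat * L kappa k)) by ring.
apply Rmult_le_compat_l; [lra | nra].
Qed.

Lemma sq_ex_series : ex_series (fun k => N k * L kappa k ^ 2).
Proof.
apply ex_series_dominated with (fun k => L kappa 0%nat * (N k * L kappa k)).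
- apply sq_term_bounds.
- apply (ex_series_scal_l (K := R_AbsRing) (V := R_NormedModule)), dof_ex_series.
Qed.

Lemma sq_le_dof : Series (fun k => N k * L kappa k ^ 2) <= L kappa 0%nat * dof kappa.
Proof.
rewrite <- Series_scal_l. apply Series_le; [apply sq_term_bounds |].
apply (ex_series_scal_l (K := R_AbsRing) (V := R_NormedModule)), dof_ex_series.
Qed.

(** [sum_pow_mul_le] with [a = L] and [b = L (1 - L)]. [B] is left free: a large cutoff makes the
    coefficient of the second term as small as desired. *)
Lemma dof_minus_sq_le B k1 :
  1 <= B -> B <= INR k1 -> B * z <= INR k1 ^ 2 ->
  dof kappa - Series (fun k => N k * L kappa k ^ 2) <=
    4 * (INR k1 + 1) ^ (d - 1) + 8 * INR (d - 2) * INR (fact (d - 2)) / B * dof kappa.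
Proof.
intros HB H1 H2.
rewrite <- Series_minus by (apply dof_ex_series || apply sq_ex_series).
assert (HL : forall k, 0 < L kappa k < 1) by (intros k; apply ratio_bounds; [apply wpos | exact Hkappa]).
set (b := fun k => L kappa k * (1 - L kappa k)).
(* Both sides contain the factor [1 - L k = kappa / (w k + kappa)]. What remains is the ratio bound
   for [w], with the denominator on the right lowered from [w k + kappa] to [w (S k) + kappa]. *)
assert (Hb : forall k, b k * INR k <= (INR k + z) * (L kappa k - L kappa (S k))).
{ intros k. pose proof (wpos k) as Hk. pose proof (wpos (S k)) as HSk.
  pose proof (bessel_like_decr d z w Hw k) as Hdec.
  pose proof (bessel_like_ratio_le d z w Hw k) as Hr. pose proof (pos_INR k). unfold b.
  replace (L kappa k * (1 - L kappa k)) with (kappa / (w k + kappa) * (w k / (w k + kappa))) by (field; lra).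
  replace (L kappa k - L kappa (S k)) with (kappa / (w k + kappa) * ((w k - w (S k)) / (w (S k) + kappa))) by (field; lra).
  assert (Hq : 0 < kappa / (w k + kappa)) by (apply Rdiv_lt_0_compat; lra).
  assert (Hinv : w k / (w k + kappa) * INR k <= (INR k + z) * ((w k - w (S k)) / (w (S k) + kappa))).
  { apply Rle_trans with ((INR k + z) * (w k - w (S k)) / (w k + kappa)).
    - replace (w k / (w k + kappa) * INR k) with (w k * INR k / (w k + kappa)) by (field; lra).
      apply Rmult_le_compat_r; [left; apply Rinv_0_lt_compat; lra |]. lra.
    - replace ((INR k + z) * ((w k - w (S k)) / (w (S k) + kappa)))
        with ((INR k + z) * (w k - w (S k)) / (w (S k) + kappa)) by (field; lra).
      apply Rmult_le_compat_l; [apply Rmult_le_pos; lra |]. apply Rinv_le_contravar; lra. }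
  rewrite Rmult_assoc, (Rmult_comm (INR k + z)), Rmult_assoc, (Rmult_comm _ (INR k + z)).
  apply Rmult_le_compat_l; [lra | exact Hinv]. }
assert (H := fun n => sum_pow_mul_le (d - 2) z B 1 (fun k => L kappa k) b k1 n
  ltac:(lra) HB H1 H2 (fun k => conj (Rlt_le _ _ (proj1 (HL k))) (Rlt_le _ _ (proj2 (HL k))))
  (fun k => filter_antitone k (S k) ltac:(lia)) ltac:(intros k; unfold b; pose proof (HL k); nra) Hb).
replace (S (d - 2)) with (d - 1)%nat in H by lia.
apply Series_le_of_sum_n_le.
{ apply (ex_series_minus (V := R_NormedModule)); [apply dof_ex_series | apply sq_ex_series]. }
intros n. specialize (H n). pose proof (pos_INR (d - 2)) as Hp.
assert (E1 : sum_n (fun k => N k * L kappa k - N k * L kappa k ^ 2) n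
             <= 2 * sum_n (fun k => (INR k + 1) ^ (d - 2) * b k) n).
{ rewrite <- sum_n_Rmult_l. apply sum_n_Rle. intros k _.
  replace (N k * L kappa k - N k * L kappa k ^ 2) with (N k * b k) by (unfold b; ring).
  rewrite <- Rmult_assoc. apply Rmult_le_compat_r; [unfold b; pose proof (HL k); nra | now apply INR_Nmult_le]. }
assert (E2 : sum_n (fun k => (INR k + 1) ^ (d - 2) * L kappa k) n <= 2 * INR (fact (d - 2)) * dof kappa).
{ apply Rle_trans with (2 * INR (fact (d - 2)) * sum_n (fun k => N k * L kappa k) n).
  - rewrite <- sum_n_Rmult_l. apply sum_n_Rle. intros k _. rewrite <- Rmult_assoc.
    apply Rmult_le_compat_r; [pose proof (HL k); lra | now apply INR_Nmult_ge].
  - apply Rmult_le_compat_l; [pose proof (INR_fact_lt_0 (d - 2)); lra |].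
    apply sum_n_le_Series; [intros; apply dof_term_bounds | apply dof_ex_series]. }
assert (HpB : 0 <= 4 * INR (d - 2) / B) by (apply Rmult_le_pos; [lra | left; apply Rinv_0_lt_compat; lra]).
pose proof (Rmult_le_compat_l _ _ _ HpB E2) as E3.
replace (8 * INR (d - 2) * INR (fact (d - 2)) / B * dof kappa)
  with (4 * INR (d - 2) / B * (2 * INR (fact (d - 2)) * dof kappa)) by (field; lra).
replace (2 * INR (d - 2) / B) with (/ 2 * (4 * INR (d - 2) / B)) in H by (field; lra).
lra.
Qed.

End Kappa.

Lemma dof_antitone k1 k2 : 0 < k1 -> k1 <= k2 -> dof k2 <= dof k1.
Proof.
intros H1 H2. apply Series_le; [| now apply dof_ex_series].
intros k. split; [apply dof_term_bounds; lra |].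
apply Rmult_le_compat_l; [apply pos_INR |]. apply ratio_mono; [apply wpos | lra | exact H1 | exact H2].
Qed.

Lemma dof_lipschitz k0 k1 k2 : 0 < k0 -> k0 <= k1 -> k1 <= k2 ->
  dof k1 - dof k2 <= Series (fun k => N k * w k) / (k0 * k0) * (k2 - k1).
Proof.
intros H0 H1 H2.
rewrite <- Series_minus by (apply dof_ex_series; lra).
replace (Series (fun k => N k * w k) / (k0 * k0) * (k2 - k1))
  with (((k2 - k1) / (k0 * k0)) * Series (fun k => N k * w k)) by (field; lra).
rewrite <- Series_scal_l. apply Series_le.
2: { apply (ex_series_scal_l (K := R_AbsRing) (V := R_NormedModule)), trace_ex_series. }
intros k. pose proof (wpos k) as Hk. pose proof (pos_INR (Nmult d k)).
assert (Hden : / ((w k + k1) * (w k + k2)) <= / (k0 * k0)) by (apply Rinv_le_contravar; nra).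
replace (N k * L k1 k - N k * L k2 k) with (N k * w k * (k2 - k1) * / ((w k + k1) * (w k + k2))) by (field; lra).
replace ((k2 - k1) / (k0 * k0) * (N k * w k)) with (N k * w k * (k2 - k1) * / (k0 * k0)) by (field; lra).
assert (0 <= N k * w k * (k2 - k1)) by (repeat apply Rmult_le_pos; lra).
split.
- apply Rmult_le_pos; [assumption | left; apply Rinv_0_lt_compat; nra].
- now apply Rmult_le_compat_l.
Qed.

(** This gives the choice made in [kappa0] its meaning. At [kappa = w K] the filter at degree [K] is
    [1/2], so the sum exceeds any [M] for [K] large; for large [kappa] it is at most the trace over
    [kappa]. *)
Lemma exists_kappa M : 0 < M -> exists kappa, 0 < kappa /\ dof kappa = M.
Proof.
intros HM. pose proof (count_const_pos d Hd) as Hq.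
set (T := Series (fun k => N k * w k)).
assert (HT : 0 <= T).
{ apply Series_nonneg; [| apply trace_ex_series].
  intros k. apply Rmult_le_pos; [apply pos_INR | left; apply wpos]. }
destruct (nfloor_ex (2 * count_const d * M)) as [K [_ HK]]; [nra |].
assert (H1 : M <= dof (w K)).
{ pose proof (count_filter_le_dof (w K) (wpos K) K) as Hc.
  replace (w K / (w K + w K)) with (/ 2) in Hc by (field; pose proof (wpos K); lra).
  assert (INR K + 1 <= (INR K + 1) ^ (d - 1)).
  { rewrite <- (pow_1 (INR K + 1)) at 1. apply Rle_pow; [pose proof (pos_INR K); lra | lia]. }
  apply (Rmult_le_reg_l (count_const d)); [exact Hq |]. lra. }
pose proof (wpos K) as HwK.
set (k0 := w K) in *.
(* The intermediate value theorem asks for continuity on the whole line; the absolute value keeps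
   the ridge above [k0], where the Lipschitz bound is uniform. *)
set (g := fun t => dof (k0 + Rabs t)).
assert (Hlip : forall s t, Rabs (g s - g t) <= T / (k0 * k0) * Rabs (s - t)).
{ assert (Hle : forall s t, Rabs s <= Rabs t -> Rabs (g s - g t) <= T / (k0 * k0) * Rabs (s - t)).
  { intros s t Hst. unfold g. pose proof (Rabs_pos s).
    pose proof (dof_antitone (k0 + Rabs s) (k0 + Rabs t) ltac:(lra) ltac:(lra)).
    rewrite Rabs_pos_eq by lra.
    apply Rle_trans with (1 := dof_lipschitz k0 (k0 + Rabs s) (k0 + Rabs t) HwK ltac:(lra) ltac:(lra)).
    apply Rmult_le_compat_l.
    - apply Rmult_le_pos; [exact HT | left; apply Rinv_0_lt_compat; nra].
    - pose proof (Rabs_triang_inv t s). rewrite Rabs_minus_sym. lra. }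
  intros s t. destruct (Rle_dec (Rabs s) (Rabs t)); [now apply Hle |].
  rewrite Rabs_minus_sym, (Rabs_minus_sym s). apply Hle. lra. }
assert (Hcont : continuity g).
{ intros t eps Heps. set (c := T / (k0 * k0)) in *.
  assert (Hc : 0 <= c) by (apply Rmult_le_pos; [exact HT | left; apply Rinv_0_lt_compat; nra]).
  exists (eps / (c + 1)). split; [apply Rdiv_lt_0_compat; lra |].
  intros s [_ Hs]. unfold dist in *; simpl in *. unfold R_dist in *.
  apply Rle_lt_trans with (1 := Hlip s t).
  apply Rle_lt_trans with ((c + 1) * Rabs (s - t)).
  - apply Rmult_le_compat_r; [apply Rabs_pos | lra].
  - apply (Rmult_lt_compat_l (c + 1)) in Hs; [| lra].
    replace ((c + 1) * (eps / (c + 1))) with eps in Hs by (field; lra). exact Hs. }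
assert (HTM : 0 <= T / M) by (apply Rmult_le_pos; [exact HT | left; now apply Rinv_0_lt_compat]).
assert (H2 : g (T / M) <= M).
{ unfold g. rewrite Rabs_pos_eq by exact HTM.
  apply Rle_trans with (1 := dof_le_trace (k0 + T / M) ltac:(lra)). fold T.
  apply (Rmult_le_reg_r (k0 + T / M)); [lra |].
  unfold Rdiv at 1. rewrite Rmult_assoc, Rinv_l, Rmult_1_r by lra.
  replace (M * (k0 + T / M)) with (M * k0 + T) by (field; lra). nra. }
assert (H3 : M <= g 0) by (unfold g; rewrite Rabs_R0, Rplus_0_r; exact H1).
destruct (IVT_gen g 0 (T / M) M Hcont) as [t [_ Ht]].
- rewrite Rmin_right, Rmax_left by lra. lra.
- exists (k0 + Rabs t). split; [pose proof (Rabs_pos t); lra | exact Ht].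
Qed.

End Spectrum.

(** * The effective ridge in the three regimes *)

(** [x] is the square root of the Bessel argument, hence the degree scale at which the spectrum
    bends; it is later [sqrt 2 / tau], with [M] the sample size. *)
Definition equilibrium (d : nat) (x : R) (w : nat -> R) (kappa M : R) : Prop :=
  0 < x /\ bessel_like d (x ^ 2) w /\ 0 < kappa /\ 0 < M /\
  Series (fun k => INR (Nmult d k) * (w k / (w k + kappa))) = M.

Lemma pow_le_mul_pow a b c n : 0 <= a -> 0 <= c -> a <= c * b -> a ^ n <= c ^ n * b ^ n.
Proof. intros Ha Hc H. rewrite <- Rpow_mult_distr. apply pow_incr. lra. Qed.

Lemma pow_ge_id y n : 1 <= y -> (1 <= n)%nat -> y <= y ^ n.
Proof. intros Hy Hn. rewrite <- (pow_1 y) at 1. now apply Rle_pow. Qed.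

Lemma pow_le_id y n : 0 <= y <= 1 -> (1 <= n)%nat -> y ^ n <= y.
Proof.
intros Hy Hn. destruct n as [|n]; [lia |]. simpl.
assert (y ^ n <= 1) by (rewrite <- (pow1 n); apply pow_incr; lra). nra.
Qed.

Lemma exp_le_compat x y : x <= y -> exp x <= exp y.
Proof. intros [H | ->]; [left; now apply exp_increasing | right; reflexivity]. Qed.

Lemma bessel_like_ge_exp d z w K G : bessel_like d z w ->
  INR K ^ 2 + INR d * INR K <= G * z -> exp (- G) * w 0%nat <= w K.
Proof.
intros Hw HG. pose proof (proj1 (proj2 Hw)) as Hz.
apply Rle_trans with (2 := bessel_like_ge d z w Hw K). rewrite Rmult_comm.
apply Rmult_le_compat_l; [left; apply (bessel_like_pos d z w Hw) |].
apply exp_le_compat, Ropp_le_contravar, (Rmult_le_reg_r z); [exact Hz |].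
replace ((INR K ^ 2 + INR d * INR K) / z * z) with (INR K ^ 2 + INR d * INR K) by (field; lra).
exact HG.
Qed.

(** At a degree about [A * x] the exponent of [bessel_like_ge] is at most [A^2 + d A / x]; the lower
    bound [x0] makes it uniform in [x]. *)
Lemma floor_ge_exp d x w A x0 : bessel_like d (x ^ 2) w -> 0 < A -> 0 < x0 -> x0 <= x ->
  exists K, A * x <= INR K + 1 /\ exp (- (A ^ 2 + INR d * A / x0)) * w 0%nat <= w K.
Proof.
intros Hw HA Hx0 Hx.
destruct (nfloor_ex (A * x)) as [K [HK1 HK2]]; [nra |].
exists K. split; [lra |]. apply (bessel_like_ge_exp d (x ^ 2)); [exact Hw |].
pose proof (pos_INR K). pose proof (pos_INR d).
assert (H1 : INR K ^ 2 <= A ^ 2 * x ^ 2) by (apply pow_le_mul_pow; lra).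
assert (H2 : INR d * INR K <= INR d * A / x0 * x ^ 2).
{ apply Rle_trans with (INR d * (A * x)); [apply Rmult_le_compat_l; lra |].
  replace (INR d * A / x0 * x ^ 2) with (INR d * (A * x) * (x / x0)) by (field; lra).
  rewrite <- (Rmult_1_r (INR d * (A * x))) at 1. apply Rmult_le_compat_l; [nra |].
  apply (Rmult_le_reg_r x0); [exact Hx0 |]. replace (x / x0 * x0) with x by (field; lra). lra. }
lra.
Qed.

Lemma exists_cutoff_linear B x : 1 <= B -> 0 <= x ->
  exists k1, B <= INR k1 /\ B * x ^ 2 <= INR k1 ^ 2 /\ INR k1 + 1 <= (B + 2) * (x + 1).
Proof.
intros HB Hx. destruct (nfloor_ex (B * (x + 1))) as [n [Hn1 Hn2]]; [nra |].
exists (S n). rewrite S_INR. repeat split; [nra | | nra].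
apply Rle_trans with ((B * x) ^ 2); [simpl; nra | apply pow_incr; nra].
Qed.

(** At a degree [K] about [x], flatness gives [L_0 <= E * L_K], and counting the degrees up to [K]
    bounds [x^(d-1) * L_K] by a multiple of [M]. *)
Lemma equilibrium_filter_small d x w kappa M : equilibrium d x w kappa M -> 1 <= x ->
  x ^ (d - 1) * (w 0%nat / (w 0%nat + kappa)) <= count_const d * exp (1 + INR d) * M.
Proof.
intros (Hx & Hw & Hk & HM & Heq) H1.
destruct (floor_ge_exp d x w 1 1 Hw) as (K & HK & He); try lra.
pose proof (count_filter_le_dof d (x ^ 2) w Hw kappa Hk K) as Hc. rewrite Heq in Hc.
replace (1 ^ 2 + INR d * 1 / 1) with (1 + INR d) in He by field.
set (E := exp (1 + INR d)) in *. assert (HE : 0 < E) by apply exp_pos.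
rewrite exp_Ropp in He. fold E in He.
pose proof (bessel_like_pos d _ w Hw 0) as H0. pose proof (bessel_like_pos d _ w Hw K) as HwK.
pose proof (bessel_like_antitone d _ w Hw 0 K ltac:(lia)) as HwK0.
pose proof (ratio_bounds _ _ HwK Hk) as HL.
assert (HL0 : w 0%nat / (w 0%nat + kappa) <= E * (w K / (w K + kappa))).
{ apply Rle_trans with (E * w K / (w 0%nat + kappa)).
  - apply Rmult_le_compat_r; [left; apply Rinv_0_lt_compat; lra |].
    apply (Rmult_le_reg_l (/ E)); [now apply Rinv_0_lt_compat |].
    rewrite <- Rmult_assoc, Rinv_l, Rmult_1_l by lra. exact He.
  - unfold Rdiv. rewrite Rmult_assoc. apply Rmult_le_compat_l; [lra |].
    apply Rmult_le_compat_l; [lra |]. apply Rinv_le_contravar; lra. }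
assert (Hpow : x ^ (d - 1) <= (INR K + 1) ^ (d - 1)) by (apply pow_incr; lra).
assert (Hpx : 0 <= x ^ (d - 1)) by (apply pow_le; lra).
apply Rle_trans with (x ^ (d - 1) * (E * (w K / (w K + kappa)))); [now apply Rmult_le_compat_l |].
replace (x ^ (d - 1) * (E * (w K / (w K + kappa)))) with (E * (x ^ (d - 1) * (w K / (w K + kappa)))) by ring.
replace (count_const d * E * M) with (E * (count_const d * M)) by ring.
apply Rmult_le_compat_l; [lra |]. apply Rle_trans with (2 := Hc). apply Rmult_le_compat_r; lra.
Qed.

(* The degrees up to [A x] carry more than [2 M] eigenfunctions, so the filter is at most
   [1/2] at the top one, whose eigenvalue is comparable to [w 0]. *)
Lemma equilibrium_filter_gap d c x0 : (2 <= d)%nat -> 0 < c -> 0 < x0 ->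
  exists delta, 0 < delta /\ forall x w kappa M, equilibrium d x w kappa M -> x0 <= x ->
    M <= c * x ^ (d - 1) -> delta <= 1 - w 0%nat / (w 0%nat + kappa).
Proof.
intros Hd Hc Hx0. pose proof (count_const_pos d Hd) as Hq.
(* Large enough that [A^(d-1) >= A >= 2 * count_const d * c], which yields twice the count needed to
   push the filter at [K] down to [1/2]. *)
set (A := 1 + 2 * count_const d * c).
assert (HA : 1 <= A) by (unfold A; nra).
set (e := exp (- (A ^ 2 + INR d * A / x0))). assert (He0 : 0 < e) by apply exp_pos.
(* A filter value at most [1/2] means [kappa >= w K >= e * w 0], and
   [1 - L_0 = kappa / (kappa + w 0)] increases with [kappa]. *)
exists (e / (1 + e)). split; [apply Rdiv_lt_0_compat; lra |].
intros x w kappa M (Hx & Hw & Hk & HM & Heq) Hx0x HMx.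
destruct (floor_ge_exp d x w A x0 Hw) as (K & HK & He); try lra. fold e in He.
pose proof (count_filter_le_dof d (x ^ 2) w Hw kappa Hk K) as Hcount. rewrite Heq in Hcount.
pose proof (bessel_like_pos d _ w Hw 0) as H0. pose proof (bessel_like_pos d _ w Hw K) as HwK.
assert (HpK : A ^ (d - 1) * x ^ (d - 1) <= (INR K + 1) ^ (d - 1)).
{ rewrite <- Rpow_mult_distr. apply pow_incr. nra. }
assert (Hpx : 0 < x ^ (d - 1)) by now apply pow_lt.
assert (HAn : A <= A ^ (d - 1)) by (apply pow_ge_id; [exact HA | lia]).
assert (HKM : 2 * count_const d * M <= (INR K + 1) ^ (d - 1)).
{ apply Rle_trans with (2 := HpK). apply Rle_trans with (A * x ^ (d - 1)).
  - apply Rle_trans with (2 * count_const d * (c * x ^ (d - 1))); [apply Rmult_le_compat_l; lra |].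
    unfold A. nra.
  - apply Rmult_le_compat_r; lra. }
assert (Hhalf : w K / (w K + kappa) <= / 2).
{ pose proof (ratio_bounds _ _ HwK Hk).
  apply (Rmult_le_reg_l (2 * count_const d * M)); [apply Rmult_lt_0_compat; lra |].
  apply Rle_trans with ((INR K + 1) ^ (d - 1) * (w K / (w K + kappa))); [apply Rmult_le_compat_r; lra |].
  lra. }
assert (HwKk : w K <= kappa).
{ apply (Rmult_le_compat_r (w K + kappa)) in Hhalf; [| lra].
  replace (w K / (w K + kappa) * (w K + kappa)) with (w K) in Hhalf by (field; lra). lra. }
assert (Hew : 0 < e * w 0%nat) by nra.
replace (1 - w 0%nat / (w 0%nat + kappa)) with (kappa / (kappa + w 0%nat)) by (field; lra).
apply (Rmult_le_reg_r ((1 + e) * (kappa + w 0%nat))); [nra |].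
replace (e / (1 + e) * ((1 + e) * (kappa + w 0%nat))) with (e * (kappa + w 0%nat)) by (field; lra).
replace (kappa / (kappa + w 0%nat) * ((1 + e) * (kappa + w 0%nat))) with (kappa * (1 + e)) by (field; lra).
nra.
Qed.

(* The trace bound gives [kappa <= s * w 0], hence the filter is bounded below on the
   degrees up to [x], which carry a positive fraction of [M] eigenfunctions. *)
Lemma equilibrium_sq_ge d c c' x0 : (2 <= d)%nat -> 0 < c -> 0 < c' -> 0 < x0 ->
  exists theta, 0 < theta /\ forall x w kappa M, equilibrium d x w kappa M -> x0 <= x ->
    x ^ (d - 1) <= c * M -> M <= c' * x ^ (d - 1) ->
    theta * M <= Series (fun k => INR (Nmult d k) * (w k / (w k + kappa)) ^ 2).
Proof.
intros Hd Hc Hc' Hx0. pose proof (count_const_pos d Hd) as Hq.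
set (B := 4 * INR (d - 2) + 1). assert (HB : 1 <= B) by (unfold B; pose proof (pos_INR (d - 2)); lra).
set (D := (B + 2) * (1 + / x0)).
assert (Hix0 : 0 < / x0) by now apply Rinv_0_lt_compat.
assert (HD : 0 < D) by (unfold D; nra).
(* [D] is such that [k1 + 1 <= D * x] for [x >= x0], so the trace is at most [8 * w 0 * D^(d-1) *
   x^(d-1) <= s * M * w 0], while [M * kappa] is at most the trace. *)
set (s := 8 * (D ^ (d - 1) * c)).
assert (Hs : 0 < s) by (unfold s; pose proof (pow_lt D (d - 1) HD); nra).
set (e := exp (- (1 ^ 2 + INR d * 1 / x0))). assert (He0 : 0 < e) by apply exp_pos.
set (l := e / (e + s)). assert (Hl : 0 < l) by (apply Rdiv_lt_0_compat; lra).
exists (l ^ 2 / (count_const d * c')). split.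
{ apply Rdiv_lt_0_compat; [now apply pow_lt | nra]. }
intros x w kappa M (Hx & Hw & Hk & HM & Heq) Hx0x HxM HMx.
pose proof (bessel_like_pos d _ w Hw) as Hpos. pose proof (Hpos 0%nat) as H0.
destruct (exists_cutoff_linear B x HB ltac:(lra)) as (k1 & Hk1 & Hk2 & Hk3).
assert (HkD : (INR k1 + 1) ^ (d - 1) <= D ^ (d - 1) * x ^ (d - 1)).
{ apply pow_le_mul_pow; [pose proof (pos_INR k1); lra | lra |].
  apply Rle_trans with (1 := Hk3). unfold D. rewrite Rmult_assoc. apply Rmult_le_compat_l; [lra |].
  assert (1 <= / x0 * x); [| lra].
  rewrite <- (Rinv_l x0) by lra. apply Rmult_le_compat_l; lra. }
assert (Htr : Series (fun k => INR (Nmult d k) * w k) <= s * M * w 0%nat).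
{ apply Rle_trans with (8 * w 0%nat * (INR k1 + 1) ^ (d - 1)).
  - apply Series_le_of_sum_n_le; [now apply (trace_ex_series d (x ^ 2)) |].
    intros n. now apply (trace_sum_le d (x ^ 2)).
  - replace (s * M * w 0%nat) with (8 * w 0%nat * (D ^ (d - 1) * (c * M))) by (unfold s; ring).
    apply Rmult_le_compat_l; [lra |]. apply Rle_trans with (1 := HkD).
    apply Rmult_le_compat_l; [left; now apply pow_lt | exact HxM]. }
assert (Hkap : kappa <= s * w 0%nat).
{ pose proof (dof_le_trace d (x ^ 2) w Hw kappa Hk) as Ht. rewrite Heq in Ht.
  apply (Rmult_le_reg_l M); [exact HM |].
  apply (Rmult_le_compat_r kappa) in Ht; [| lra].
  replace (Series (fun k => INR (Nmult d k) * w k) / kappa * kappa)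
    with (Series (fun k => INR (Nmult d k) * w k)) in Ht by (field; lra). nra. }
destruct (floor_ge_exp d x w 1 x0 Hw) as (K & HK & He); try lra. fold e in He. rewrite Rmult_1_l in HK.
assert (Hew : 0 < e * w 0%nat) by nra.
assert (Hsw : 0 < s * w 0%nat) by nra.
assert (HLl : forall k, (k <= K)%nat -> l <= w k / (w k + kappa)).
{ intros k HkK. apply Rle_trans with (w K / (w K + kappa)).
  - replace l with (e * w 0%nat / (e * w 0%nat + s * w 0%nat)) by (unfold l; field; split; nra || lra).
    apply ratio_mono; assumption.
  - now apply (filter_antitone d (x ^ 2)). }
assert (Hsum : l ^ 2 * sum_n (fun k => INR (Nmult d k)) K <= Series (fun k => INR (Nmult d k) * (w k / (w k + kappa)) ^ 2)).
{ apply Rle_trans with (sum_n (fun k => INR (Nmult d k) * (w k / (w k + kappa)) ^ 2) K).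
  - rewrite <- sum_n_Rmult_l. apply sum_n_Rle. intros k HkK. rewrite Rmult_comm.
    apply Rmult_le_compat_l; [apply pos_INR |]. apply pow_incr. split; [lra | now apply HLl].
  - apply sum_n_le_Series.
    + intros k. apply (sq_term_bounds d (x ^ 2) w Hw kappa Hk).
    + now apply (sq_ex_series d (x ^ 2)). }
apply Rle_trans with (2 := Hsum).
assert (Hl2 : 0 < l ^ 2) by now apply pow_lt.
pose proof (pow_le_sum_Nmult d K Hd) as Hcount.
assert (x ^ (d - 1) <= (INR K + 1) ^ (d - 1)) by (apply pow_incr; lra).
apply (Rmult_le_reg_r (count_const d * c')); [nra |].
replace (l ^ 2 / (count_const d * c') * M * (count_const d * c')) with (l ^ 2 * M) by (field; lra).
rewrite Rmult_assoc. apply Rmult_le_compat_l; [lra |].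
apply Rle_trans with (1 := HMx).
replace (sum_n (fun k => INR (Nmult d k)) K * (count_const d * c'))
  with (c' * (count_const d * sum_n (fun k => INR (Nmult d k)) K)) by ring.
apply Rmult_le_compat_l; lra.
Qed.

(** [B] is chosen with [T / B <= eps]. The constant [C] then depends on [eps], which is harmless
    when [x^(d-1)] is [o(M)]. The [+ 1] covers small [x]: here the bandwidth may grow without
    bound. *)
Lemma equilibrium_deficit_le d eps : (2 <= d)%nat -> 0 < eps ->
  exists C, 0 < C /\ forall x w kappa M, equilibrium d x w kappa M ->
    M - Series (fun k => INR (Nmult d k) * (w k / (w k + kappa)) ^ 2) <= eps * M + C * (x ^ (d - 1) + 1).
Proof.
intros Hd Heps. set (T := 8 * INR (d - 2) * INR (fact (d - 2))).
assert (HT : 0 <= T).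
{ unfold T. pose proof (pos_INR (d - 2)). pose proof (INR_fact_lt_0 (d - 2)). nra. }
set (B := 1 + T / eps).
assert (HTe : 0 <= T / eps) by (apply Rmult_le_pos; [exact HT | left; now apply Rinv_0_lt_compat]).
assert (HTB : T / B <= eps).
{ apply (Rmult_le_reg_r B); [unfold B; lra |].
  unfold Rdiv at 1. rewrite Rmult_assoc, Rinv_l, Rmult_1_r by (unfold B; lra).
  replace (eps * B) with (eps + T) by (unfold B; field; lra). lra. }
exists (4 * ((2 * (B + 2)) ^ (d - 1))). split.
{ apply Rmult_lt_0_compat; [lra |]. apply pow_lt. unfold B. lra. }
intros x w kappa M (Hx & Hw & Hk & HM & Heq).
destruct (exists_cutoff_linear B x ltac:(unfold B; lra) ltac:(lra)) as (k1 & Hk1 & Hk2 & Hk3).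
pose proof (dof_minus_sq_le d (x ^ 2) w Hw kappa Hk B k1 ltac:(unfold B; lra) Hk1 Hk2) as H.
rewrite Heq in H. fold T in H.
apply Rle_trans with (1 := H). rewrite Rplus_comm. apply Rplus_le_compat.
- apply Rmult_le_compat_r; lra.
- rewrite Rmult_assoc. apply Rmult_le_compat_l; [lra |].
  assert (HB2 : 0 < 2 * (B + 2)) by (unfold B; lra).
  destruct (Rle_dec x 1) as [Hx1 | Hx1].
  + apply Rle_trans with ((2 * (B + 2)) ^ (d - 1) * 1 ^ (d - 1)).
    * apply pow_le_mul_pow; [pose proof (pos_INR k1); lra | lra | nra].
    * apply Rmult_le_compat_l; [left; now apply pow_lt |]. rewrite pow1.
      pose proof (pow_lt x (d - 1) Hx). lra.
  + apply Rle_trans with ((2 * (B + 2)) ^ (d - 1) * x ^ (d - 1)).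
    * apply pow_le_mul_pow; [pose proof (pos_INR k1); lra | lra | nra].
    * apply Rmult_le_compat_l; [left; now apply pow_lt | lra].
Qed.

(** * Predicted risk *)

Lemma kappa0_equilibrium d tau m : (2 <= d)%nat -> 0 < tau -> (1 <= m)%nat ->
  equilibrium d (sqrt 2 / tau) (lam d tau) (kappa0 d tau m) (INR m).
Proof.
intros Hd Htau Hm. assert (HM : 0 < INR m) by (apply lt_0_INR; lia).
pose proof Rlt_sqrt2_0 as H2.
assert (Hx2 : (sqrt 2 / tau) ^ 2 = 2 / tau ^ 2).
{ replace ((sqrt 2 / tau) ^ 2) with (sqrt 2 * sqrt 2 / tau ^ 2) by (field; lra).
  rewrite sqrt_sqrt by lra. reflexivity. }
pose proof (lam_bessel_like d tau Hd Htau) as Hw.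
assert (Hk : 0 < kappa0 d tau m /\ eff_dof d tau (kappa0 d tau m) = INR m).
{ unfold kappa0. apply epsilon_spec. exact (exists_kappa d _ _ Hw (INR m) HM). }
unfold equilibrium. rewrite Hx2.
repeat split; try apply Hw; try apply Hk; [now apply Rdiv_lt_0_compat | exact HM].
Qed.

(** * Bandwidth against sample size *)

Lemma scale_pos d m : 0 < scale d m.
Proof. apply exp_pos. Qed.

Lemma scale_pow d m : (2 <= d)%nat -> (1 <= m)%nat -> scale d m ^ (d - 1) = / INR m.
Proof.
intros Hd Hm. assert (HM : 0 < INR m) by (apply lt_0_INR; lia).
assert (0 < INR (d - 1)) by (apply lt_0_INR; lia).
rewrite <- Rpower_pow by apply scale_pos. unfold scale.
rewrite Rpower_mult. replace (- (1 / INR (d - 1)) * INR (d - 1)) with (- (1)) by (field; lra).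
rewrite Rpower_Ropp, Rpower_1 by exact HM. reflexivity.
Qed.

Lemma scale_le_1 d m : (2 <= d)%nat -> (1 <= m)%nat -> scale d m <= 1.
Proof.
intros Hd Hm. apply Rnot_lt_le. intros H.
pose proof (scale_pow d m Hd Hm) as Hp.
pose proof (pow_ge_id (scale d m) (d - 1) ltac:(lra) ltac:(lia)) as Hs.
assert (1 <= INR m) by (apply (le_INR 1) in Hm; exact Hm).
assert (/ INR m <= / 1) by (apply Rinv_le_contravar; lra). rewrite Rinv_1 in *. lra.
Qed.

(** The dictionary between the regimes: comparing [tau] with [scale d m] amounts to comparing [m]
    with [x^(d-1)] for [x = sqrt 2 / tau]. *)
Lemma inv_bandwidth_pow d m tau : (2 <= d)%nat -> (1 <= m)%nat -> 0 < tau ->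
  (sqrt 2 / tau) ^ (d - 1) * (tau / scale d m) ^ (d - 1) = sqrt 2 ^ (d - 1) * INR m.
Proof.
intros Hd Hm Htau. pose proof (scale_pos d m).
assert (HM : 0 < INR m) by (apply lt_0_INR; lia).
rewrite <- Rpow_mult_distr.
replace (sqrt 2 / tau * (tau / scale d m)) with (sqrt 2 * / scale d m) by (field; lra).
rewrite Rpow_mult_distr, pow_inv, scale_pow, Rinv_inv by assumption. reflexivity.
Qed.

Lemma sample_le_inv_bandwidth_pow d m tau C2 : (2 <= d)%nat -> (1 <= m)%nat -> 0 < tau ->
  tau <= C2 * scale d m ->
  INR m <= (C2 / sqrt 2) ^ (d - 1) * (sqrt 2 / tau) ^ (d - 1) /\ sqrt 2 / C2 <= sqrt 2 / tau.
Proof.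
intros Hd Hm Htau Hle. pose proof (scale_pos d m) as Hs. pose proof Rlt_sqrt2_0 as H2.
assert (HC2 : 0 < C2) by nra.
pose proof (inv_bandwidth_pow d m tau Hd Hm Htau) as E. split.
- apply (Rmult_le_reg_l (sqrt 2 ^ (d - 1))); [now apply pow_lt |]. rewrite <- E.
  rewrite <- !Rpow_mult_distr.
  replace (sqrt 2 * (C2 / sqrt 2 * (sqrt 2 / tau))) with (sqrt 2 / tau * C2) by (field; lra).
  assert (Hr : tau / scale d m <= C2).
  { apply (Rmult_le_reg_r (scale d m)); [exact Hs |].
    replace (tau / scale d m * scale d m) with tau by (field; lra). exact Hle. }
  assert (0 < sqrt 2 / tau) by now apply Rdiv_lt_0_compat.
  assert (0 < tau / scale d m) by now apply Rdiv_lt_0_compat.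
  apply pow_incr. split; [nra | apply Rmult_le_compat_l; lra].
- apply Rmult_le_compat_l; [lra |]. apply Rinv_le_contravar; [exact Htau |].
  pose proof (scale_le_1 d m Hd Hm). nra.
Qed.

Lemma inv_bandwidth_pow_le_sample d m tau C1 : (2 <= d)%nat -> (1 <= m)%nat -> 0 < C1 ->
  C1 * scale d m <= tau ->
  (sqrt 2 / tau) ^ (d - 1) <= (sqrt 2 / C1) ^ (d - 1) * INR m.
Proof.
intros Hd Hm HC1 Hle. pose proof (scale_pos d m) as Hs. pose proof Rlt_sqrt2_0 as H2.
assert (Htau : 0 < tau) by nra.
apply (Rmult_le_reg_l (C1 ^ (d - 1))); [now apply pow_lt |].
rewrite <- Rmult_assoc, <- !Rpow_mult_distr.
replace (C1 * (sqrt 2 / C1)) with (sqrt 2) by (field; lra).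
rewrite <- (inv_bandwidth_pow d m tau Hd Hm Htau), <- Rpow_mult_distr.
assert (Hr : C1 <= tau / scale d m).
{ apply (Rmult_le_reg_r (scale d m)); [exact Hs |].
  replace (tau / scale d m * scale d m) with tau by (field; lra). exact Hle. }
assert (0 < sqrt 2 / tau) by now apply Rdiv_lt_0_compat.
apply pow_incr. split; [nra |]. rewrite Rmult_comm. apply Rmult_le_compat_l; lra.
Qed.

(** * Bounds on the risk at a fixed bandwidth and sample size *)

Lemma deg_energy_nonneg d beta k : 0 <= deg_energy d beta k.
Proof.
unfold deg_energy, fsum. induction (List.seq 0 (Nmult d k)) as [|j l IH]; simpl; [lra |].
pose proof (pow2_ge_0 (beta k j)). simpl in *. lra.
Qed.

Section Risk.

Context (d : nat) (Hd : (2 <= d)%nat) (tau : R) (Htau : 0 < tau) (m : nat) (Hm : (1 <= m)%nat)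
  (sigma2 : R) (Hsigma2 : 0 < sigma2) (beta : nat -> nat -> R) (Hbeta : ex_series (deg_energy d beta)).

Let L0 := Lk d tau m 0.
Let V := Series (fun k => INR (Nmult d k) * Lk d tau m k ^ 2).
Let S := Series (fun k => (1 - Lk d tau m k) ^ 2 * deg_energy d beta k).
Let F := fstar_sq d beta.

Lemma Lk_bounds k : 0 < Lk d tau m k < 1.
Proof.
destruct (kappa0_equilibrium d tau m Hd Htau Hm) as (_ & Hw & Hk & _).
apply ratio_bounds; [apply (bessel_like_pos _ _ _ Hw) | exact Hk].
Qed.

Lemma Lk_le_Lk0 k : Lk d tau m k <= L0.
Proof.
destruct (kappa0_equilibrium d tau m Hd Htau Hm) as (_ & Hw & Hk & _).
apply (filter_antitone _ _ _ Hw _ Hk). lia.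
Qed.

Lemma variance_le : V <= L0 * INR m.
Proof.
destruct (kappa0_equilibrium d tau m Hd Htau Hm) as (_ & Hw & Hk & _ & Heq).
rewrite <- Heq. apply (sq_le_dof _ _ _ Hw _ Hk).
Qed.

Lemma variance_pos : 0 < V.
Proof.
destruct (kappa0_equilibrium d tau m Hd Htau Hm) as (_ & Hw & Hk & _).
apply Rlt_le_trans with (sum_n (fun k => INR (Nmult d k) * Lk d tau m k ^ 2) 0).
- rewrite sum_O. simpl Nmult. rewrite Rmult_1_l. apply pow_lt, Lk_bounds.
- apply sum_n_le_Series.
  + intros k. apply (sq_term_bounds _ _ _ Hw _ Hk).
  + apply (sq_ex_series _ _ _ Hw _ Hk).
Qed.

Lemma bias_term_bounds k :
  (1 - L0) ^ 2 * deg_energy d beta k <= (1 - Lk d tau m k) ^ 2 * deg_energy d beta k <= deg_energy d beta k.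
Proof.
pose proof (Lk_bounds k). pose proof (Lk_bounds 0) as HL0. fold L0 in HL0. pose proof (Lk_le_Lk0 k).
pose proof (deg_energy_nonneg d beta k). split.
- apply Rmult_le_compat_r; [assumption |]. apply pow_incr. lra.
- rewrite <- (Rmult_1_l (deg_energy d beta k)) at 2. apply Rmult_le_compat_r; [assumption |].
  rewrite <- (pow1 2). apply pow_incr. lra.
Qed.

Lemma fstar_sq_nonneg : 0 <= F.
Proof. apply Series_nonneg; [apply deg_energy_nonneg | exact Hbeta]. Qed.

Lemma bias_ex_series : ex_series (fun k => (1 - Lk d tau m k) ^ 2 * deg_energy d beta k).
Proof.
apply ex_series_dominated with (2 := Hbeta). intros k. split; [| apply bias_term_bounds].
apply Rmult_le_pos; [apply pow2_ge_0 | apply deg_energy_nonneg].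
Qed.

Lemma bias_bounds : (1 - L0) ^ 2 * F <= S <= F.
Proof.
assert (Hpos : forall k y, 0 <= y ^ 2 * deg_energy d beta k).
{ intros k y. apply Rmult_le_pos; [apply pow2_ge_0 | apply deg_energy_nonneg]. }
split.
- unfold F, fstar_sq. rewrite <- Series_scal_l. apply Series_le; [| exact bias_ex_series].
  intros k. split; [apply Hpos | apply bias_term_bounds].
- apply Series_le; [| exact Hbeta]. intros k. split; [apply Hpos | apply bias_term_bounds].
Qed.

Lemma pred_risk_mul : pred_risk d tau m sigma2 beta * (INR m - V) = INR m * (S + sigma2).
Proof.
assert (0 < INR m) by (apply lt_0_INR; lia).
pose proof variance_le. pose proof (Lk_bounds 0) as HL0. fold L0 in HL0.
unfold pred_risk, E0. fold V S. field. nra.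
Qed.

Lemma variance_lt : V < INR m.
Proof.
assert (0 < INR m) by (apply lt_0_INR; lia).
pose proof variance_le. pose proof (Lk_bounds 0) as HL0. fold L0 in HL0. nra.
Qed.

Lemma pred_risk_le : pred_risk d tau m sigma2 beta * (1 - L0) <= F + sigma2.
Proof.
assert (HM : 0 < INR m) by (apply lt_0_INR; lia).
pose proof variance_lt. pose proof variance_le. pose proof pred_risk_mul as E. pose proof bias_bounds.
pose proof (Lk_bounds 0) as HL0. fold L0 in HL0. pose proof fstar_sq_nonneg.
assert (0 <= (1 - L0) ^ 2 * F) by (apply Rmult_le_pos; [apply pow2_ge_0 | assumption]).
assert (HR : 0 <= pred_risk d tau m sigma2 beta).
{ apply Rnot_lt_le. intros Hneg. nra. }
apply (Rmult_le_reg_l (INR m)); [exact HM |].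
apply Rle_trans with (pred_risk d tau m sigma2 beta * (INR m - V)).
- replace (INR m * (pred_risk d tau m sigma2 beta * (1 - L0)))
    with (pred_risk d tau m sigma2 beta * (INR m - L0 * INR m)) by ring.
  apply Rmult_le_compat_l; lra.
- rewrite E. apply Rmult_le_compat_l; lra.
Qed.

(** [E_0 = 1 / (1 - V / m) >= 1 / (1 - theta) >= 1 + theta], and every bias factor is at least
    [(1 - L_0)^2]. *)
Lemma pred_risk_ge theta : 0 <= theta -> theta * INR m <= V ->
  (1 + theta) * ((1 - L0) ^ 2 * F + sigma2) <= pred_risk d tau m sigma2 beta.
Proof.
intros Ht HtV. assert (HM : 0 < INR m) by (apply lt_0_INR; lia).
pose proof variance_lt. pose proof pred_risk_mul as E. pose proof bias_bounds. pose proof fstar_sq_nonneg.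
assert (0 <= (1 - L0) ^ 2 * F) by (apply Rmult_le_pos; [apply pow2_ge_0 | assumption]).
set (Y := (1 - L0) ^ 2 * F + sigma2) in *. assert (0 < Y) by (unfold Y; lra).
apply (Rmult_le_reg_r (INR m - V)); [lra |]. rewrite E.
apply Rle_trans with (INR m * Y).
- assert (HF : (1 + theta) * (INR m - V) <= INR m) by nra.
  replace ((1 + theta) * Y * (INR m - V)) with (Y * ((1 + theta) * (INR m - V))) by ring.
  rewrite (Rmult_comm (INR m)). apply Rmult_le_compat_l; lra.
- apply Rmult_le_compat_l; unfold Y; lra.
Qed.

Lemma pred_risk_noise : INR m * sigma2 <= pred_risk d tau m sigma2 beta * (INR m - V).
Proof.
rewrite pred_risk_mul. apply Rmult_le_compat_l; [apply pos_INR |].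
pose proof bias_bounds. pose proof fstar_sq_nonneg.
assert (0 <= (1 - L0) ^ 2 * F) by (apply Rmult_le_pos; [apply pow2_ge_0 | assumption]). lra.
Qed.

(** [(1 - L_0)^2 >= 1 - 2 L_0]. Strictness, even for a zero target, comes from [E_0 > 1], that is
    from [V > 0]. *)
Lemma pred_risk_gt : sigma2 + (1 - 2 * L0) * F < pred_risk d tau m sigma2 beta.
Proof.
assert (HM : 0 < INR m) by (apply lt_0_INR; lia). pose proof variance_pos as HV.
pose proof fstar_sq_nonneg.
assert (Ht : 0 < V / INR m) by now apply Rdiv_lt_0_compat.
assert (HtV : V / INR m * INR m <= V) by (right; field; lra).
apply Rlt_le_trans with (2 := pred_risk_ge (V / INR m) (Rlt_le _ _ Ht) HtV).
assert (0 <= L0 ^ 2 * F) by (apply Rmult_le_pos; [apply pow2_ge_0 | assumption]).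
assert (0 <= (1 - L0) ^ 2 * F) by (apply Rmult_le_pos; [apply pow2_ge_0 | assumption]).
assert (sigma2 + (1 - 2 * L0) * F <= (1 - L0) ^ 2 * F + sigma2) by lra.
nra.
Qed.

End Risk.

(** * The risk in the three bandwidth regimes *)

Lemma Lk0_small d : (2 <= d)%nat -> exists Q, 0 < Q /\ forall tau m, 0 < tau -> (1 <= m)%nat ->
  tau <= scale d m -> Lk d tau m 0 <= Q * (tau / scale d m) ^ (d - 1).
Proof.
intros Hd. pose proof (count_const_pos d Hd) as Hq. pose proof (exp_pos (1 + INR d)) as He.
pose proof Rlt_sqrt2_0 as H2.
assert (Hs1 : 1 <= sqrt 2) by (rewrite <- sqrt_1; apply sqrt_le_1_alt; lra).
exists (count_const d * exp (1 + INR d)). split; [nra |].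
intros tau m Htau Hm Hle.
pose proof (scale_pos d m) as Hs. pose proof (scale_le_1 d m Hd Hm).
assert (HM : 0 < INR m) by (apply lt_0_INR; lia).
assert (Hx : 1 <= sqrt 2 / tau).
{ apply (Rmult_le_reg_r tau); [exact Htau |].
  replace (sqrt 2 / tau * tau) with (sqrt 2) by (field; lra). lra. }
pose proof (equilibrium_filter_small _ _ _ _ _ (kappa0_equilibrium d tau m Hd Htau Hm) Hx) as H0.
change (lam d tau 0 / (lam d tau 0 + kappa0 d tau m)) with (Lk d tau m 0) in H0.
pose proof (inv_bandwidth_pow d m tau Hd Hm Htau) as E.
set (X := (sqrt 2 / tau) ^ (d - 1)) in *. set (r := (tau / scale d m) ^ (d - 1)) in *.
assert (HX : 0 < X) by (apply pow_lt; lra).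
assert (Hr : 0 < r) by (apply pow_lt; now apply Rdiv_lt_0_compat).
assert (Hmx : INR m <= X * r).
{ rewrite E. rewrite <- (Rmult_1_l (INR m)) at 1. apply Rmult_le_compat_r; [lra |].
  apply pow_R1_Rle. exact Hs1. }
apply (Rmult_le_reg_l X); [exact HX |]. apply Rle_trans with (1 := H0).
replace (X * (count_const d * exp (1 + INR d) * r)) with (count_const d * exp (1 + INR d) * (X * r)) by ring.
apply Rmult_le_compat_l; [nra | exact Hmx].
Qed.

(** Serves both the small and the critical bandwidths: an upper bound on [tau] alone keeps [L_0]
    away from [1], and the risk is then at most [(F + sigma2) / delta]. *)
Lemma limsup_pred_risk_finite d sigma2 beta tau C2 : (2 <= d)%nat ->
  0 < sigma2 -> ex_series (deg_energy d beta) -> (forall m, 0 < tau m) -> 0 < C2 ->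
  (exists N, forall m, (N <= m)%nat -> tau m <= C2 * scale d m) ->
  Rbar_lt (LimSup_seq (fun m => pred_risk d (tau m) m sigma2 beta)) p_infty.
Proof.
intros Hd Hs Hb Htau HC2 [N HN]. pose proof Rlt_sqrt2_0 as H2.
destruct (equilibrium_filter_gap d ((C2 / sqrt 2) ^ (d - 1)) (sqrt 2 / C2) Hd) as (delta & Hdelta & Hgap).
- apply pow_lt. now apply Rdiv_lt_0_compat.
- now apply Rdiv_lt_0_compat.
- apply Rbar_le_lt_trans with (LimSup_seq (fun _ => (fstar_sq d beta + sigma2) / delta)).
  + apply LimSup_le. exists (S N). intros m Hm.
    assert (Hm1 : (1 <= m)%nat) by lia.
    destruct (sample_le_inv_bandwidth_pow d m (tau m) C2 Hd Hm1 (Htau m) (HN m ltac:(lia))) as [Ha Hc].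
    specialize (Hgap _ _ _ _ (kappa0_equilibrium d (tau m) m Hd (Htau m) Hm1) Hc Ha).
    change (delta <= 1 - Lk d (tau m) m 0) in Hgap.
    pose proof (pred_risk_le d Hd (tau m) (Htau m) m Hm1 sigma2 Hs beta Hb) as Hle.
    pose proof (fstar_sq_nonneg d beta Hb) as HF.
    set (R0 := pred_risk d (tau m) m sigma2 beta) in *.
    apply (Rmult_le_reg_r delta); [exact Hdelta |].
    replace ((fstar_sq d beta + sigma2) / delta * delta) with (fstar_sq d beta + sigma2) by (field; lra).
    destruct (Rle_dec 0 R0); nra.
  + rewrite LimSup_seq_const. exact I.
Qed.

Lemma pred_risk_lower_small_tau d : (2 <= d)%nat -> exists Q, 0 < Q /\
  forall sigma2 beta tau m, 0 < sigma2 -> ex_series (deg_energy d beta) -> 0 < tau -> (1 <= m)%nat ->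
    tau <= scale d m ->
    sigma2 + (1 - Q * (tau / scale d m) ^ (d - 1)) * fstar_sq d beta < pred_risk d tau m sigma2 beta.
Proof.
intros Hd. destruct (Lk0_small d Hd) as (Q & HQ & H). exists (2 * Q). split; [lra |].
intros sigma2 beta tau m Hs Hb Htau Hm Hle.
apply Rle_lt_trans with (2 := pred_risk_gt d Hd tau Htau m Hm sigma2 Hs beta Hb).
apply Rplus_le_compat_l, Rmult_le_compat_r; [exact (fstar_sq_nonneg d beta Hb) |].
specialize (H tau m Htau Hm Hle). lra.
Qed.

Lemma tau_le_scale_mul d m tau r : tau / scale d m <= r -> tau <= r * scale d m.
Proof.
intros H. pose proof (scale_pos d m).
apply (Rmult_le_compat_r (scale d m)) in H; [| lra].
replace (tau / scale d m * scale d m) with tau in H by (field; lra). exact H.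
Qed.

Lemma eventually_lt_of_lim_0 (u : nat -> R) eps : is_lim_seq u 0 -> 0 < eps ->
  exists N, forall m, (N <= m)%nat -> u m < eps.
Proof.
intros Hu Heps. apply is_lim_seq_spec in Hu.
destruct (Hu (mkposreal eps Heps)) as [N HN]. exists N. intros m Hm.
specialize (HN m Hm). simpl in HN. apply Rabs_def2 in HN. lra.
Qed.

Lemma pred_risk_small_tau d sigma2 beta tau : (2 <= d)%nat ->
  0 < sigma2 -> ex_series (deg_energy d beta) -> (forall m, 0 < tau m) ->
  is_lim_seq (fun m => tau m / scale d m) 0 ->
  Rbar_le (null_risk d sigma2 beta) (LimInf_seq (fun m => pred_risk d (tau m) m sigma2 beta)) /\
  Rbar_lt (LimSup_seq (fun m => pred_risk d (tau m) m sigma2 beta)) p_infty.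
Proof.
intros Hd Hs Hb Htau Hlim.
destruct (eventually_lt_of_lim_0 _ 1 Hlim Rlt_0_1) as [N HN].
assert (HN' : forall m, (N <= m)%nat -> tau m <= 1 * scale d m).
{ intros m Hm. apply tau_le_scale_mul. left. now apply HN. }
split.
- destruct (pred_risk_lower_small_tau d Hd) as (Q & HQ & H).
  set (F := fstar_sq d beta).
  pose proof (fstar_sq_nonneg d beta Hb) as HF. fold F in HF.
  (* The power [d - 1] of the ratio is replaced by the ratio itself, which is larger once below [1]
     and tends to [0] by hypothesis. *)
  set (u := fun m => sigma2 + (1 - Q * (tau m / scale d m)) * F).
  assert (Hu : is_lim_seq u (null_risk d sigma2 beta)).
  { replace (null_risk d sigma2 beta) with (sigma2 + (1 - Q * 0) * F) by (unfold null_risk, F; ring).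
    apply is_lim_seq_plus'; [apply is_lim_seq_const |].
    apply is_lim_seq_mult'; [| apply is_lim_seq_const].
    apply is_lim_seq_minus'; [apply is_lim_seq_const |].
    apply is_lim_seq_mult'; [apply is_lim_seq_const | exact Hlim]. }
  rewrite <- (is_LimInf_seq_unique _ _ (is_lim_LimInf_seq _ _ Hu)).
  apply LimInf_le. exists (S N). intros m Hm. left.
  apply Rle_lt_trans with (2 := H sigma2 beta (tau m) m Hs Hb (Htau m) ltac:(lia) ltac:(rewrite <- Rmult_1_l; apply HN'; lia)).
  apply Rplus_le_compat_l, Rmult_le_compat_r; [exact HF |].
  apply Rplus_le_compat_l, Ropp_le_contravar, Rmult_le_compat_l; [lra |].
  apply pow_le_id; [| lia]. specialize (HN m ltac:(lia)).
  assert (0 < tau m / scale d m) by (apply Rdiv_lt_0_compat; [apply Htau | apply scale_pos]). lra.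
- apply (limsup_pred_risk_finite d sigma2 beta tau 1 Hd Hs Hb Htau Rlt_0_1). now exists N.
Qed.

Lemma pred_risk_small_tau_rate d : (2 <= d)%nat -> exists c : R,
  forall (sigma2 : R) (beta : nat -> nat -> R) (tau t : nat -> R),
    0 < sigma2 -> ex_series (deg_energy d beta) -> (forall m, 0 < tau m) ->
    (forall m : nat, (1 <= m)%nat -> tau m <= scale d m * t m) -> is_lim_seq t 0 ->
    exists m0 : nat, forall m : nat, (m0 < m)%nat ->
      pred_risk d (tau m) m sigma2 beta >
      sigma2 + (1 - c * Rpower (t m) (INR (d - 1) / 2)) * fstar_sq d beta.
Proof.
intros Hd. destruct (pred_risk_lower_small_tau d Hd) as (Q & HQ & H). exists Q.
intros sigma2 beta tau t Hs Hb Htau Hle Ht.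
destruct (eventually_lt_of_lim_0 t 1 Ht Rlt_0_1) as [N HN]. exists N. intros m Hm.
pose proof (scale_pos d m) as Hsc. pose proof (Htau m) as Htm.
specialize (HN m ltac:(lia)). specialize (Hle m ltac:(lia)).
assert (Htpos : 0 < t m) by nra.
assert (Hr : tau m / scale d m <= t m).
{ apply (Rmult_le_reg_r (scale d m)); [exact Hsc |].
  replace (tau m / scale d m * scale d m) with (tau m) by (field; lra). lra. }
assert (Hts : tau m <= scale d m) by nra.
apply Rle_lt_trans with (2 := H sigma2 beta (tau m) m Hs Hb Htm ltac:(lia) Hts).
apply Rplus_le_compat_l, Rmult_le_compat_r; [exact (fstar_sq_nonneg d beta Hb) |].
apply Rplus_le_compat_l, Ropp_le_contravar, Rmult_le_compat_l; [lra |].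
apply Rle_trans with (t m ^ (d - 1)).
- apply pow_incr. split; [left; now apply Rdiv_lt_0_compat | exact Hr].
(* The estimate has the full power [t^(d-1)], the square of the half power [y]; since [t m < 1],
   [y * y <= y]. *)
- pose proof (pos_INR (d - 1)).
  rewrite <- Rpower_pow by exact Htpos.
  replace (INR (d - 1)) with (INR (d - 1) / 2 + INR (d - 1) / 2) at 1 by field.
  rewrite Rpower_plus. set (y := Rpower (t m) (INR (d - 1) / 2)).
  assert (0 < y) by apply exp_pos.
  assert (y <= 1) by (apply Rpower_le_1; lra). nra.
Qed.

Lemma pred_risk_large_tau d sigma2 beta tau : (2 <= d)%nat ->
  0 < sigma2 -> ex_series (deg_energy d beta) -> (forall m, 0 < tau m) ->
  is_lim_seq (fun m => tau m / scale d m) p_infty ->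
  is_lim_seq (fun m => pred_risk d (tau m) m sigma2 beta) p_infty.
Proof.
intros Hd Hs Hb Htau Hlim. apply is_lim_seq_spec. intros M.
pose proof Rlt_sqrt2_0 as H2.
set (M' := Rabs M + 1). assert (HM' : 0 < M') by (unfold M'; pose proof (Rabs_pos M); lra).
(* If [m - V <= eps * m], the noise alone gives a risk of at least [sigma2 / eps = M' > M]. Each of
   the three terms of the deficit bound receives a third of [eps * m]; the two thresholds below
   control [C * X] and [C]. *)
set (eps := sigma2 / M'). assert (Heps : 0 < eps) by now apply Rdiv_lt_0_compat.
destruct (equilibrium_deficit_le d (eps / 3) Hd ltac:(lra)) as (C & HC & Hdef).
assert (H2p : 0 < sqrt 2 ^ (d - 1)) by now apply pow_lt.
apply is_lim_seq_spec in Hlim.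
destruct (Hlim (1 + 3 * C * sqrt 2 ^ (d - 1) / eps)) as [N1 HN1].
destruct (nfloor_ex (3 * C / eps)) as [N2 [_ HN2]].
{ left. apply Rdiv_lt_0_compat; lra. }
exists (1 + N1 + N2)%nat. intros m Hm. assert (Hm1 : (1 <= m)%nat) by lia.
specialize (HN1 m ltac:(lia)). pose proof (scale_pos d m) as Hsc. pose proof (Htau m) as Htm.
assert (HmN2 : INR N2 + 1 <= INR m) by (rewrite <- S_INR; apply le_INR; lia).
assert (HmR : 0 < INR m) by (pose proof (pos_INR N2); lra).
set (r := tau m / scale d m) in *.
assert (Hc1 : 0 < 3 * C * sqrt 2 ^ (d - 1) / eps) by (apply Rdiv_lt_0_compat; nra).
assert (Hrn : r <= r ^ (d - 1)) by (apply pow_ge_id; [lra | lia]).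
pose proof (inv_bandwidth_pow d m (tau m) Hd Hm1 Htm) as E. fold r in E.
specialize (Hdef _ _ _ _ (kappa0_equilibrium d (tau m) m Hd Htm Hm1)).
set (X := (sqrt 2 / tau m) ^ (d - 1)) in *.
assert (HX : 0 < X) by (apply pow_lt; now apply Rdiv_lt_0_compat).
assert (HCX : C * X <= eps / 3 * INR m).
{ apply (Rmult_le_reg_l (3 * sqrt 2 ^ (d - 1) / eps)); [apply Rdiv_lt_0_compat; lra |].
  replace (3 * sqrt 2 ^ (d - 1) / eps * (eps / 3 * INR m)) with (sqrt 2 ^ (d - 1) * INR m) by (field; lra).
  rewrite <- E.
  replace (3 * sqrt 2 ^ (d - 1) / eps * (C * X)) with (X * (3 * C * sqrt 2 ^ (d - 1) / eps)) by (field; lra).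
  apply Rmult_le_compat_l; lra. }
assert (HCm : C <= eps / 3 * INR m).
{ apply (Rmult_le_reg_l (3 / eps)); [apply Rdiv_lt_0_compat; lra |].
  replace (3 / eps * (eps / 3 * INR m)) with (INR m) by (field; lra).
  replace (3 / eps * C) with (3 * C / eps) by (field; lra). lra. }
pose proof (pred_risk_noise d Hd (tau m) Htm m Hm1 sigma2 beta Hb) as Hnoise.
pose proof (variance_lt d Hd (tau m) Htm m Hm1) as Hlt.
change (INR m - Series (fun k => INR (Nmult d k) * Lk d (tau m) m k ^ 2) <= eps / 3 * INR m + C * (X + 1)) in Hdef.
set (V := Series (fun k => INR (Nmult d k) * Lk d (tau m) m k ^ 2)) in *.
set (R0 := pred_risk d (tau m) m sigma2 beta) in *.
assert (HMR : M' <= R0).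
{ apply (Rmult_le_reg_r (INR m - V)); [lra |]. apply Rle_trans with (2 := Hnoise).
  apply Rle_trans with (M' * (eps * INR m)); [apply Rmult_le_compat_l; lra |].
  right. unfold eps. field. lra. }
pose proof (Rle_abs M). unfold M' in *. lra.
Qed.

Lemma pred_risk_critical_tau d C1 C2 : (2 <= d)%nat -> 0 < C1 -> 0 < C2 ->
  exists eta mu : R, 0 < eta /\ 0 < mu /\
    forall (sigma2 : R) (beta : nat -> nat -> R) (tau : R) (m : nat),
      0 < sigma2 -> ex_series (deg_energy d beta) -> (1 <= m)%nat ->
      C1 * scale d m <= tau <= C2 * scale d m ->
      pred_risk d tau m sigma2 beta > mu * fstar_sq d beta + (1 + eta) * sigma2.
Proof.
intros Hd HC1 HC2. pose proof Rlt_sqrt2_0 as H2.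
assert (Hp1 : 0 < (sqrt 2 / C1) ^ (d - 1)) by (apply pow_lt; now apply Rdiv_lt_0_compat).
assert (Hp2 : 0 < (C2 / sqrt 2) ^ (d - 1)) by (apply pow_lt; now apply Rdiv_lt_0_compat).
assert (Hx0 : 0 < sqrt 2 / C2) by now apply Rdiv_lt_0_compat.
destruct (equilibrium_filter_gap d _ _ Hd Hp2 Hx0) as (delta & Hdelta & Hgap).
destruct (equilibrium_sq_ge d _ _ _ Hd Hp1 Hp2 Hx0) as (theta & Htheta & Hsq).
(* Halving [theta] makes the inequality strict, because [sigma2 > 0]. *)
exists (theta / 2), (delta ^ 2). split; [lra |]. split; [now apply pow_lt |].
intros sigma2 beta tau m Hs Hb Hm [Hlo Hhi].
assert (Htau : 0 < tau) by (pose proof (scale_pos d m); nra).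
pose proof (kappa0_equilibrium d tau m Hd Htau Hm) as He.
destruct (sample_le_inv_bandwidth_pow d m tau C2 Hd Hm Htau Hhi) as [Ha Hc].
pose proof (inv_bandwidth_pow_le_sample d m tau C1 Hd Hm HC1 Hlo) as Hx.
specialize (Hgap _ _ _ _ He Hc Ha). change (delta <= 1 - Lk d tau m 0) in Hgap.
specialize (Hsq _ _ _ _ He Hc Hx Ha).
pose proof (pred_risk_ge d Hd tau Htau m Hm sigma2 Hs beta Hb theta ltac:(lra) Hsq) as Hge.
pose proof (fstar_sq_nonneg d beta Hb) as HF.
apply Rlt_le_trans with (2 := Hge).
assert (Hd2 : delta ^ 2 * fstar_sq d beta <= (1 - Lk d tau m 0) ^ 2 * fstar_sq d beta).
{ apply Rmult_le_compat_r; [exact HF |]. apply pow_incr. lra. }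
assert (0 <= delta ^ 2 * fstar_sq d beta) by (apply Rmult_le_pos; [apply pow2_ge_0 | exact HF]).
nra.
Qed.

Theorem theorem1 (d : nat) (hd : (2 <= d)%nat) :
  (* Part 1: tau_m = o(m^{-1/(d-1)}) *)
  (forall (sigma2 : R) (beta : nat -> nat -> R) (tau : nat -> R),
     0 < sigma2 -> ex_series (deg_energy d beta) ->
     (forall m, 0 < tau m) ->
     is_lim_seq (fun m => tau m / scale d m) 0 ->
     Rbar_le (null_risk d sigma2 beta)
             (LimInf_seq (fun m => pred_risk d (tau m) m sigma2 beta)) /\
     Rbar_lt (LimSup_seq (fun m => pred_risk d (tau m) m sigma2 beta)) p_infty) /\
  (exists c : R,
     forall (sigma2 : R) (beta : nat -> nat -> R) (tau t : nat -> R),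
       0 < sigma2 -> ex_series (deg_energy d beta) ->
       (forall m, 0 < tau m) ->
       (forall m : nat, (1 <= m)%nat -> tau m <= scale d m * t m) ->
       is_lim_seq t 0 ->
       exists m0 : nat, forall m : nat, (m0 < m)%nat ->
         pred_risk d (tau m) m sigma2 beta >
         sigma2 + (1 - c * Rpower (t m) (INR (d - 1) / 2)) * fstar_sq d beta) /\
  (* Part 2: tau_m = omega(m^{-1/(d-1)}) *)
  (forall (sigma2 : R) (beta : nat -> nat -> R) (tau : nat -> R),
     0 < sigma2 -> ex_series (deg_energy d beta) ->
     (forall m, 0 < tau m) ->
     is_lim_seq (fun m => tau m / scale d m) p_infty ->
     is_lim_seq (fun m => pred_risk d (tau m) m sigma2 beta) p_infty /\
     exists m0 : nat, forall m : nat, (m0 <= m)%nat ->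
       pred_risk d (tau m) m sigma2 beta > null_risk d sigma2 beta) /\
  (* Part 3: tau_m = Theta(m^{-1/(d-1)}) *)
  (forall (sigma2 : R) (beta : nat -> nat -> R) (tau : nat -> R),
     0 < sigma2 -> ex_series (deg_energy d beta) ->
     (forall m, 0 < tau m) ->
     (exists C1 C2 : R, 0 < C1 /\ 0 < C2 /\ exists N : nat, forall m : nat,
        (N <= m)%nat -> C1 * scale d m <= tau m <= C2 * scale d m) ->
     Rbar_lt (LimSup_seq (fun m => pred_risk d (tau m) m sigma2 beta)) p_infty) /\
  (forall C1 C2 : R, 0 < C1 -> 0 < C2 ->
     exists eta mu : R, 0 < eta /\ 0 < mu /\
       forall (sigma2 : R) (beta : nat -> nat -> R) (tau : nat -> R),
         0 < sigma2 -> ex_series (deg_energy d beta) ->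
         (forall m, 0 < tau m) ->
         (forall m : nat, (1 <= m)%nat ->
            C1 * scale d m <= tau m <= C2 * scale d m) ->
         (forall m : nat, (1 <= m)%nat ->
            pred_risk d (tau m) m sigma2 beta >
            mu * fstar_sq d beta + (1 + eta) * sigma2) /\
         (sigma2 > (1 - mu) / eta * fstar_sq d beta ->
          forall m : nat, (1 <= m)%nat ->
            pred_risk d (tau m) m sigma2 beta > null_risk d sigma2 beta)).
Proof.
split; [| split; [| split; [| split]]].
- intros sigma2 beta tau Hs Hb Htau Hlim. now apply pred_risk_small_tau.
- now apply pred_risk_small_tau_rate.
- intros sigma2 beta tau Hs Hb Htau Hlim.
  pose proof (pred_risk_large_tau d sigma2 beta tau hd Hs Hb Htau Hlim) as Hinf.
  split; [exact Hinf |].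
  apply is_lim_seq_spec in Hinf. exact (Hinf (null_risk d sigma2 beta)).
- intros sigma2 beta tau Hs Hb Htau (C1 & C2 & _ & HC2 & N & HN).
  apply (limsup_pred_risk_finite d sigma2 beta tau C2 hd Hs Hb Htau HC2).
  exists N. intros m Hm. now apply HN.
- intros C1 C2 HC1 HC2.
  destruct (pred_risk_critical_tau d C1 C2 hd HC1 HC2) as (eta & mu & Heta & Hmu & H).
  exists eta, mu. split; [exact Heta |]. split; [exact Hmu |].
  intros sigma2 beta tau Hs Hb Htau Hbw.
  assert (Hrisk : forall m, (1 <= m)%nat -> pred_risk d (tau m) m sigma2 beta >
                    mu * fstar_sq d beta + (1 + eta) * sigma2).
  { intros m Hm. apply H; auto. }
  split; [exact Hrisk |].
  intros Hnoise m Hm. apply Rgt_trans with (1 := Hrisk m Hm).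
  apply (Rmult_gt_compat_l eta) in Hnoise; [| exact Heta].
  replace (eta * ((1 - mu) / eta * fstar_sq d beta)) with ((1 - mu) * fstar_sq d beta) in Hnoise
    by (field; lra).
  unfold null_risk. lra.
Qed.
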